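(* Let $Y$ be a rich solid QBF-space on $X$ and let the analyzing frame $\mathcal F=\{\varphi_x\}_{x\in X}$ possess property $F(\nu,Y)$. Further, let $\mathcal G=\{\psi_x\}_{x\in X}\subset\mathcal H_1^\nu$ be a family and $\mathcal U=\{U_i\}_{i\in I}$ an admissible covering of $X$ such that $K^*_{\mathcal U}:=K^*_{\mathcal U}[\mathcal G,\mathcal F]$ defines a bounded operator on $Y$. Then for $f\in\mathrm{Co}(\mathcal F,Y)$ the function $\sum_{i\in I}\sup_{z\in U_i}|V_{\mathcal G}f(z)|\chi_{U_i}$ belongs to $Y$ with the estimate $$\Big\|\sum_{i\in I}\sup_{z\in U_i}|V_{\mathcal G}f(z)|\chi_{U_i}\Big|Y\Big\|\le\sigma(\mathcal U)\,\|K^*_{\mathcal U}|Y\to Y\|\,\|f|\mathrm{Co}(\mathcal F,Y)\| .$$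
   Context: Frame setting. $\mathcal H$ is a separable complex Hilbert space (inner product linear in the first argument); $X$ is a $\sigma$-compact locally compact Hausdorff space with a positive Radon measure $\mu$, $\operatorname{supp}\mu=X$. $\mathcal F=\{\varphi_x\}_{x\in X}\subset\mathcal H$ is a Parseval continuous frame: $x\mapsto\varphi_x$ is weakly measurable and $\|f|\mathcal H\|^2=\int_X|\langle f,\varphi_x\rangle|^2\,d\mu(x)$ for all $f\in\mathcal H$. $V_{\mathcal F}f(x)=\langle f,\varphi_x\rangle$; $R_{\mathcal F}(x,y)=\langle\varphi_y,\varphi_x\rangle$. A measurable kernel $K:X\times X\to\mathbb C$ acts by $K(F)(x)=\int_XK(x,y)F(y)\,d\mu(y)$. Weights. For a weight (measurable function) $\nu:X\to[1,\infty)$: $\|F|L_p^\nu\|=\|F\nu|L_p(X,\mu)\|$, $m_\nu(x,y)=\max\{\nu(x)/\nu(y),\nu(y)/\nu(x)\}$; $\mathcal A_{m_\nu}$ is the set of measurable $K$ with $\max\{\operatorname{ess\,sup}_x\int|K(x,y)|m_\nu(x,y)d\mu(y),\operatorname{ess\,sup}_y\int|K(x,y)|m_\nu(x,y)d\mu(x)\}<\infty$. $\mathcal H_1^\nu=\{f\in\mathcal H:V_{\mathcal F}f\in L_1^\nu(X)\}$ with norm $\|V_{\mathcal F}f|L_1^\nu\|$; $(\mathcal H_1^\nu)^\urcorner$ is its normed anti-dual (bounded conjugate-linear functionals), with duality product $\langle\cdot,\cdot\rangle$ extending the inner product of $\mathcal H$. Frame condition: (a) $\|\varphi_x|\mathcal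 H\|\le C_B\nu(x)$ for some $C_B>0$ and all $x\in X$; (b) $R_{\mathcal F}\in\mathcal A_{m_\nu}$. By convention $\mathcal F\subset\mathcal H_1^\nu$ is assumed, and $V_{\mathcal F}f(x)=\langle f,\varphi_x\rangle$ for $f\in(\mathcal H_1^\nu)^\urcorner$; likewise $V_{\mathcal G}f(x)=\langle f,\psi_x\rangle$. Function spaces. A QBF-space $Y$ on $X$ is a linear space of ($\mu$-a.e. equivalence classes of) measurable functions on $X$, complete under a quasi-norm. It is solid if $f$ measurable, $g\in Y$, $|f|\le|g|$ a.e. imply $f\in Y$, $\|f|Y\|\le\|g|Y\|$; rich if $\chi_K\in Y$ for all compact $K\subset X$. Property $F(\nu,Y)$ (for a weight $\nu\ge1$): $\mathcal F$ satisfies (a),(b), $R_{\mathcal F}:Y\to Y$ is continuous, and $R_{\mathcal F}(Y)\hookrightarrow L_\infty^{1/\nu}(X)$ continuously. Then $\mathrm{Co}(\mathcal F,Y)=\{f\in(\mathcal H_1^\nu)^\urcorner:V_{\mathcal F}f\in Y\}$, $\|f|\mathrm{Co}(\mathcal F,Y)\|=\|V_{\mathcal F}f|Y\|$. Coverings and kernels. A covering $\mathcal U=\{U_i\}_{i\in I}$ of $X$ is admissible if it is locally finite (each $x\in X$ has a neighborhood meeting only finitely many $U_i$), each $U_i$ is measurable, relatively compact, with non-void interior, and $\sigma(\mathcal U)=\sup_{i}\sharp\{j:U_i\cap U_j\ne\emptyset\}<\infty$. With $Q_y=\bigcup_{i:y\in U_i}U_i$: $K_{\mathcal U}[\mathcal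 G,\mathcal F](x,y)=\sup_{z\in Q_y}|\langle\varphi_x,\psi_z\rangle|$ and $K^*_{\mathcal U}[\mathcal G,\mathcal F](x,y)=K_{\mathcal U}[\mathcal G,\mathcal F](y,x)$. *)

(* Defs.v *)
From HB Require Import structures.
From mathcomp Require Import all_boot all_order all_algebra.
From mathcomp Require Import all_classical all_reals all_analysis.
From mathcomp Require Import ess_sup_inf.
From mathcomp Require Export complex.
Set Implicit Arguments.
Unset Strict Implicit.
Unset Printing Implicit Defensive.
Import Order.TTheory GRing.Theory Num.Theory.
Import numFieldNormedType.Exports.
Import Normc.
Local Open Scope classical_set_scope.
Local Open Scope complex_scope.
Local Open Scope ring_scope.

(* X carries its Borel sigma-algebra; "measurable" always means Borel. *)
Notation borel X := (g_sigma_algebraType (@open X)).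

Section MeasureOnX.
Context {R : realType} {X : ptopologicalType}.
Variable mu : {measure set (borel X) -> \bar R}.

Definition sigma_compact (T : topologicalType) :=
  exists K : nat -> set T, (forall n, compact (K n)) /\ \bigcup_n K n = setT.

Record radon : Prop := {
  radon_compact_fin : forall K : set X, compact K -> (mu K < +oo)%E ;
  radon_outer : forall A : set (borel X), measurable A ->
    mu A = ereal_inf [set mu U | U in [set U : set X | open U /\ A `<=` U]] ;
  radon_inner : forall U : set X, open U ->
    mu U = ereal_sup [set mu K | K in [set K : set X | compact K /\ K `<=` U]]
}.

Definition msupport : set X :=
  [set x | forall U : set X, open U -> U x -> (0 < mu U)%E].

(* Complex-valued functions are handled through real and imaginary parts;
   cintegral is a junk value when the function is not cintegrable. *)
Definition cmeasurable d (T : measurableType d) (F : T -> R[i]) : Prop :=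
  measurable_fun setT (fun x => complex.Re (F x)) /\
  measurable_fun setT (fun x => complex.Im (F x)).

Definition cintegrable (F : borel X -> R[i]) : Prop :=
  mu.-integrable setT (fun x => (complex.Re (F x))%:E) /\
  mu.-integrable setT (fun x => (complex.Im (F x))%:E).

Definition cintegral (F : borel X -> R[i]) : R[i] :=
  (\int[mu]_x complex.Re (F x)) +i* (\int[mu]_x complex.Im (F x)).

Definition weight (nu : borel X -> R) : Prop :=
  measurable_fun setT nu /\ forall x, 1 <= nu x.

Definition wLnorm (p : \bar R) (nu : X -> R) (F : borel X -> R[i]) : \bar R :=
  Lnorm mu p (fun x => (normc (F x) * nu x)%:E).

Definition in_wLp (p : \bar R) (nu : X -> R) (F : borel X -> R[i]) : Prop :=
  cmeasurable F /\ (wLnorm p nu F < +oo)%E.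

(* A space of a.e.-classes is given by the set Y of all representatives of its
   members, with N the quasi-norm evaluated on representatives; N is only
   relevant on Y. *)
Record QBF_space (Y : set (borel X -> R[i])) (N : (borel X -> R[i]) -> R) : Prop := {
  qbf_measurable : forall F, Y F -> cmeasurable F ;
  qbf_ae : forall F G, Y F -> cmeasurable G -> ae_eq mu setT F G ->
    Y G /\ N G = N F ;
  qbf_0 : Y (cst 0) ;
  qbf_add : forall F G, Y F -> Y G -> Y (fun x => F x + G x) ;
  qbf_scale : forall (a : R[i]) F, Y F -> Y (fun x => a * F x) ;
  qbf_norm_ge0 : forall F, Y F -> 0 <= N F ;
  qbf_norm_eq0 : forall F, Y F -> N F = 0 <-> ae_eq mu setT F (cst 0) ;
  qbf_normZ : forall (a : R[i]) F, Y F -> N (fun x => a * F x) = normc a * N F ;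
  qbf_quasi_triangle : exists C : R, forall F G, Y F -> Y G ->
    N (fun x => F x + G x) <= C * (N F + N G) ;
  qbf_complete : forall u : nat -> borel X -> R[i], (forall n, Y (u n)) ->
    (forall e : R, 0 < e -> exists n0 : nat, forall m n : nat,
      (n0 <= m)%N -> (n0 <= n)%N -> N (fun x => u m x - u n x) < e) ->
    exists F, Y F /\
      forall e : R, 0 < e -> exists n0 : nat, forall n : nat,
        (n0 <= n)%N -> N (fun x => u n x - F x) < e
}.

Definition solid (Y : set (borel X -> R[i])) (N : (borel X -> R[i]) -> R) : Prop :=
  forall F G, cmeasurable F -> Y G ->
    {ae mu, forall x, normc (F x) <= normc (G x)} -> Y F /\ N F <= N G.

Definition rich (Y : set (borel X -> R[i])) : Prop :=
  forall K : set X, compact K -> Y (fun x => (\1_K x : R)%:C).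

Section Kernels.
Variables (Y : set (borel X -> R[i])) (N : (borel X -> R[i]) -> R).

Definition kop (K : X -> X -> R[i]) (F : borel X -> R[i]) : borel X -> R[i] :=
  fun x => cintegral (fun y => K x y * F y).

Definition kop_maps (K : X -> X -> R[i]) : Prop :=
  forall F, Y F ->
    {ae mu, forall x, cintegrable (fun y => K x y * F y)} /\ Y (kop K F).

Definition kop_continuous (K : X -> X -> R[i]) : Prop :=
  kop_maps K /\
  forall F, Y F -> forall e : R, 0 < e -> exists d : R, 0 < d /\
    forall G, Y G -> N (fun x => G x - F x) < d ->
      N (fun x => kop K G x - kop K F x) < e.

Definition kop_bounded (K : X -> X -> R[i]) : Prop :=
  kop_maps K /\ exists C : R, forall F, Y F -> N (kop K F) <= C * N F.

Definition kop_norm (K : X -> X -> R[i]) : R :=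
  sup [set N (kop K F) | F in [set F | Y F /\ N F <= 1]].

(* A nonnegative kernel defined as a supremum may a priori take the value +oo.
   For it to define an operator it must be finite almost everywhere; the
   operator is then the one of its finite-valued representative. *)
Definition fine_kernel (K : X -> X -> \bar R) : X -> X -> R[i] :=
  fun x y => (fine (K x y))%:C.

Definition ekop_bounded (K : X -> X -> \bar R) : Prop :=
  {ae mu, forall x : borel X,
    {ae mu, forall y : borel X, K x y \is a fin_num}} /\
  kop_bounded (fine_kernel K).

End Kernels.

Definition m_weight (nu : X -> R) (x y : X) : R :=
  Num.max (nu x / nu y) (nu y / nu x).

Definition schur_kernel (nu : X -> R) (K : X -> X -> R[i]) : Prop :=
  cmeasurable (fun z : borel X * borel X => K z.1 z.2) /\
  (Order.max
    (ess_sup mu (fun x : borel X =>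
       \int[mu]_y (normc (K x y) * m_weight nu x y)%:E))
    (ess_sup mu (fun y : borel X =>
       \int[mu]_x (normc (K x y) * m_weight nu x y)%:E)) < +oo)%E.

End MeasureOnX.

Section Frames.
Context {R : realType} {X : ptopologicalType}.
Variable mu : {measure set (borel X) -> \bar R}.
Context {H : completeNormedModType R[i]}.

(* {dot H for Num.conj} is linear in its first and conjugate-linear in its
   second argument. *)
Variable ip : {dot H for Num.conj}.

Definition hilbert_separable : Prop :=
  (forall f : H, ip f f = `|f| ^+ 2) /\
  exists D : set H, countable D /\ dense D.

Definition hnorm (f : H) : R := complex.Re `|f|.

(* Voice transform of an anti-linear functional T on (a subspace of) H; the
   vector f of H is the functional ip f. *)
Definition voice (phi : X -> H) (T : H -> R[i]) : borel X -> R[i] :=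
  fun x => T (phi x).

Definition parseval_frame (phi : X -> H) : Prop :=
  forall f : H, cmeasurable (voice phi (ip f)) /\
    ((hnorm f ^+ 2)%:E = \int[mu]_x (normc (voice phi (ip f) x) ^+ 2)%:E)%E.

Definition gram_kernel (phi : X -> H) (x y : X) : R[i] := ip (phi y) (phi x).

Definition H1nu (phi : X -> H) (nu : X -> R) : set H :=
  [set f | in_wLp mu 1%E nu (voice phi (ip f))].

Definition H1nu_norm (phi : X -> H) (nu : X -> R) (f : H) : \bar R :=
  wLnorm mu 1%E nu (voice phi (ip f)).

(* A bounded conjugate-linear functional on H1nu is represented by a function on
   H of which only the values on H1nu matter: <T, f> = T f for f in H1nu. *)
Definition antidual (phi : X -> H) (nu : X -> R) : set (H -> R[i]) :=
  [set T | (forall (a : R[i]) f g, H1nu phi nu f -> H1nu phi nu g ->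
              T (a *: f + g) = a^* * T f + T g) /\
           exists C : R, forall f, H1nu phi nu f ->
             ((normc (T f))%:E <= C%:E * H1nu_norm phi nu f)%E].

Definition frame_condition (phi : X -> H) (nu : X -> R) : Prop :=
  (exists CB : R, 0 < CB /\ forall x, hnorm (phi x) <= CB * nu x) /\
  schur_kernel mu nu (gram_kernel phi).

(* The last clause is the continuous embedding of the range of the operator,
   with the quasi-norm of Y, into L_oo with weight 1 / nu. *)
Definition property_F (phi : X -> H) (nu : X -> R)
    (Y : set (borel X -> R[i])) (N : (borel X -> R[i]) -> R) : Prop :=
  [/\ frame_condition phi nu,
      kop_continuous mu Y N (gram_kernel phi)
    & exists C : R, forall F, Y F ->
        let RF := kop mu (gram_kernel phi) F in
        in_wLp mu +oo%E (fun x => (nu x)^-1) RF /\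
        (wLnorm mu +oo%E (fun x => (nu x)^-1)%R RF <= (C * N RF)%:E)%E].

Definition coorbit (phi : X -> H) (nu : X -> R) (Y : set (borel X -> R[i])) :
    set (H -> R[i]) :=
  [set T | antidual phi nu T /\ Y (voice phi T)].

Definition coorbit_norm (phi : X -> H) (N : (borel X -> R[i]) -> R)
    (T : H -> R[i]) : R := N (voice phi T).

End Frames.

Section Coverings.
Context {R : realType} {X : ptopologicalType} {I : choiceType}.
Variable U : I -> set X.

Definition cov_sigma : \bar R :=
  ereal_sup (range (fun i => counting [set j | U i `&` U j !=set0])).

Record admissible_covering : Prop := {
  cov_covers : \bigcup_i U i = setT ;
  cov_locally_finite : forall x : X, exists W : set X,
    nbhs x W /\ finite_set [set i | U i `&` W !=set0] ;
  cov_measurable : forall i, measurable (U i : set (borel X)) ;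
  cov_precompact : forall i, precompact (U i) ;
  cov_interior : forall i, (U i)° !=set0 ;
  cov_sigma_fin : (cov_sigma < +oo)%E
}.

Definition cov_Q (y : X) : set X := \bigcup_(i in [set i | U i y]) U i.

Context {H : completeNormedModType R[i]}.
Variable ip : {dot H for Num.conj}.

Definition cov_kernel (psi phi : X -> H) (x y : X) : \bar R :=
  ereal_sup [set (normc (ip (phi x) (psi z)))%:E | z in cov_Q y].

Definition cov_kernel_star (psi phi : X -> H) (x y : X) : \bar R :=
  cov_kernel psi phi y x.

Definition cov_sup_sum (F : X -> R[i]) (x : X) : \bar R :=
  (\esum_(i in [set: I])
     (ereal_sup [set (normc (F z))%:E | z in U i] * (\1_(U i) x : R)%:E))%E.

End Coverings.

(* Main.v *)
Require Import Defs.
From HB Require Import structures.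
From mathcomp Require Import finmap.
From mathcomp Require Import all_boot all_order all_algebra.
From mathcomp Require Import all_classical all_reals all_analysis.
From mathcomp Require Import measurable_realfun ess_sup_inf.
From mathcomp Require Import ring lra.
Set Implicit Arguments.
Unset Strict Implicit.
Unset Printing Implicit Defensive.
Import Order.TTheory GRing.Theory Num.Theory.
Import numFieldNormedType.Exports.
Import Normc.
Local Open Scope classical_set_scope.
Local Open Scope complex_scope.
Local Open Scope ring_scope.

(** The heart of the matter is the inequality
      |T g| <= \int |<g, phi_y>| |T phi_y| dmu(y)
    for an antidual functional [T] with measurable voice transform and a vector
    [g] of the test space [H1nu] (lemma [reproducing_inequality]).  For [T]
    given by a vector of [H] it follows from the reproducing formula of a
    Parseval frame ([reproducing]), but a general [T] is only continuous for the norm of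
    [H1nu], so [g] has to be approached in that norm by finite combinations
    [G] of vectors of [H1nu] on which [T] can be evaluated term by term.

    Such [G] are obtained by replacing the frame by a step function with values
    in [H1nu].  The space [H1nu] is separable for its own norm
    ([H1nu_separable]): on a set of finite measure where the weight is bounded
    its norm is controlled by the norm of the separable space [H], and
    integrability makes the rest small.  Hence the sets on which the
    frame is close to the k-th member of a suitable sequence cover [X]; made
    disjoint and truncated to finitely many, they give a step function [s] for which
    \int |<g, phi_y>| |phi_y - s_y|_H1nu dmu(y) is small
    ([exists_step_approximation]); the Schur bound on the Gram kernel provides
    the integrability that the truncation needs.  Integrating the voice
    transform of [g] against [s] gives [G] ([synthesis]).  By the reproducing
    formula the error [g - G] is the integral of <g, phi_y> (phi_y - s_y), so
    Tonelli's theorem bounds its norm ([H1nu_norm_sub_synthesis_le]), while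
    |T G| is at most the integral of |<g, phi_y>| |T s_y|, which is close to the
    right-hand side above.

    Taking for [g] the vectors [psi z], with [z] in a piece U_i that contains
    [x], the inner factor is at most the kernel K*(x, y), so sup over U_i of
    |T psi_z| is at most (K* |V T|)(x) for almost every [x].  At most sigma(U)
    pieces contain [x] ([cov_sup_sum_le]), so the sum in the theorem is at most
    sigma(U) K* |V T| almost everywhere, and the solidity of [Y] together with
    the definition of the operator norm ([kop_norm_le]) finishes the proof. *)

(** * Complex-valued functions and their integrals *)

Section ComplexModulus.
Context {R : realType}.
Implicit Types z w : R[i].

Lemma normc_ge0 z : 0 <= normc z.
Proof. by case: z => a b; rewrite sqrtr_ge0. Qed.

Lemma normc_conj z : normc z^* = normc z.
Proof. by case: z => a b; rewrite /= sqrrN. Qed.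

Lemma normc_real (r : R) : normc r%:C = `|r|.
Proof. by rewrite /= expr0n addr0 sqrtr_sqr. Qed.

Lemma normc_sqr z : normc z ^+ 2 = complex.Re z ^+ 2 + complex.Im z ^+ 2.
Proof. by case: z => a b /=; rewrite sqr_sqrtr // addr_ge0 ?sqr_ge0. Qed.

Lemma ler_Re_normc z : `|complex.Re z| <= normc z.
Proof. by case: z => a b /=; rewrite -sqrtr_sqr ler_wsqrtr // lerDl sqr_ge0. Qed.

Lemma ler_Im_normc z : `|complex.Im z| <= normc z.
Proof. by case: z => a b /=; rewrite -sqrtr_sqr ler_wsqrtr // lerDr sqr_ge0. Qed.

Lemma normcB_le z w : normc z <= normc w + normc (z - w).
Proof. by rewrite -{1}(subrK w z) addrC; exact: le_normcD. Qed.

Lemma exists_rotation z : exists2 u : R[i], normc u = 1 & u * z = (normc z)%:C.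
Proof.
have [->|z0] := eqVneq z 0.
  by exists 1; rewrite ?normc1 // mulr0 normc0.
have nz0 : normc z != 0 by apply: contra z0 => /eqP/eq0_normc ->.
exists ((normc z)%:C * z^-1); last by rewrite mulfVK.
by rewrite normcM normcV normc_real ger0_norm ?normc_ge0 // divff.
Qed.

End ComplexModulus.

Section ComplexMeasurability.
Context {R : realType} d {T : measurableType d}.
Implicit Types F G : T -> R[i].

Lemma cmeasurable_cst (a : R[i]) : cmeasurable (fun _ : T => a).
Proof. by split; exact: measurable_cst. Qed.

Lemma cmeasurableD F G : cmeasurable F -> cmeasurable G ->
  cmeasurable (fun x => F x + G x).
Proof.
move=> [F1 F2] [G1 G2]; split.
- rewrite [X in measurable_fun _ X](_ : _ = (fun x =>
    complex.Re (F x) + complex.Re (G x))); first exact: measurable_funD.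
  by apply/funext => x; case: (F x) (G x) => ? ? [].
- rewrite [X in measurable_fun _ X](_ : _ = (fun x =>
    complex.Im (F x) + complex.Im (G x))); first exact: measurable_funD.
  by apply/funext => x; case: (F x) (G x) => ? ? [].
Qed.

Lemma cmeasurableM F G : cmeasurable F -> cmeasurable G ->
  cmeasurable (fun x => F x * G x).
Proof.
move=> [F1 F2] [G1 G2]; split.
- rewrite [X in measurable_fun _ X](_ : _ = (fun x =>
    complex.Re (F x) * complex.Re (G x) - complex.Im (F x) * complex.Im (G x))).
    by apply: measurable_funB; exact: measurable_funM.
  by apply/funext => x; case: (F x) (G x) => ? ? [].
- rewrite [X in measurable_fun _ X](_ : _ = (fun x =>
    complex.Re (F x) * complex.Im (G x) + complex.Im (F x) * complex.Re (G x))).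
    by apply: measurable_funD; exact: measurable_funM.
  by apply/funext => x; case: (F x) (G x) => ? ? [].
Qed.

Lemma cmeasurableZ (a : R[i]) F : cmeasurable F ->
  cmeasurable (fun x => a * F x).
Proof. by move=> mF; apply: cmeasurableM => //; exact: cmeasurable_cst. Qed.

Lemma cmeasurableB F G : cmeasurable F -> cmeasurable G ->
  cmeasurable (fun x => F x - G x).
Proof.
move=> mF mG; rewrite (_ : (fun x => _) = (fun x => F x + -1 * G x)).
  by apply: cmeasurableD => //; exact: cmeasurableZ.
by apply/funext => x; rewrite mulN1r.
Qed.

Lemma cmeasurable_conj F : cmeasurable F -> cmeasurable (fun x => (F x)^*%C).
Proof.
move=> [F1 F2]; split.
- by rewrite (_ : (fun x => _) = (fun x => complex.Re (F x))) //;
    apply/funext => x; case: (F x).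
- by rewrite (_ : (fun x => _) = (fun x => - complex.Im (F x)));
    [exact: measurable_funN|apply/funext => x; case: (F x)].
Qed.

Lemma cmeasurable_sum (J : Type) (s : seq J) (F : J -> T -> R[i]) :
  (forall i, cmeasurable (F i)) -> cmeasurable (fun x => \sum_(i <- s) F i x).
Proof.
move=> mF; elim: s => [|i s ih].
  by under eq_fun do rewrite big_nil; exact: cmeasurable_cst.
by under eq_fun do rewrite big_cons; exact: cmeasurableD.
Qed.

Lemma cmeasurable_real (f : T -> R) : measurable_fun setT f ->
  cmeasurable (fun x => (f x)%:C).
Proof. by split => //=; exact: measurable_cst. Qed.

Lemma cmeasurable_comp d' (T' : measurableType d') (h : T' -> T) F :
  cmeasurable F -> measurable_fun setT h -> cmeasurable (fun x => F (h x)).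
Proof.
move=> [F1 F2] mh.
by split; [exact: (measurableT_comp F1 mh)|exact: (measurableT_comp F2 mh)].
Qed.

Lemma measurable_normc F : cmeasurable F ->
  measurable_fun setT (fun x => normc (F x)).
Proof.
move=> [F1 F2]; rewrite (_ : (fun x => _) = (fun x =>
  Num.sqrt (complex.Re (F x) ^+ 2 + complex.Im (F x) ^+ 2))).
  have msqrt : measurable_fun setT (@Num.sqrt R).
    by apply: nondecreasing_measurable => // x y; exact: ler_wsqrtr.
  apply: (measurableT_comp msqrt).
  by apply: measurable_funD; exact: measurable_funX.
by apply/funext => x; case: (F x).
Qed.

End ComplexMeasurability.

Section ComplexIntegral.
Context {R : realType} {X : ptopologicalType}.
Variable mu : {measure set (borel X) -> \bar R}.
Implicit Types F G : borel X -> R[i].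

Lemma cintegrable_cmeasurable F : cintegrable mu F -> cmeasurable F.
Proof. by move=> [/integrableP[/measurable_EFinP + _] /integrableP[/measurable_EFinP + _]]. Qed.

Lemma cintegrableP F : cintegrable mu F <->
  cmeasurable F /\ (\int[mu]_x (normc (F x))%:E < +oo)%E.
Proof.
split=> [iF|[mF oF]]; last first.
  have nF : mu.-integrable setT (fun x => (normc (F x))%:E).
    apply/integrableP; split; first exact/measurable_EFinP/measurable_normc.
    by under eq_integral do rewrite /= ger0_norm ?normc_ge0 //.
  case: mF => F1 F2; split; apply: le_integrable nF => //.
  - exact/measurable_EFinP.
  - by move=> x _; rewrite lee_fin [leRHS]ger0_norm ?normc_ge0 // ler_Re_normc.
  - exact/measurable_EFinP.
  - by move=> x _; rewrite lee_fin [leRHS]ger0_norm ?normc_ge0 // ler_Im_normc.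
split; first exact: cintegrable_cmeasurable.
have mF := cintegrable_cmeasurable iF.
case: iF => /integrable_abse i1 /integrable_abse i2.
have /integrableP[_] := integrableD measurableT i1 i2.
apply: le_lt_trans; apply: ge0_le_integral => //.
- by move=> x _; rewrite lee_fin normc_ge0.
- exact/measurable_EFinP/measurable_normc.
- apply: measurableT_comp => //; apply: emeasurable_funD.
  + by apply: measurableT_comp => //; apply/measurable_EFinP; case: mF.
  + by apply: measurableT_comp => //; apply/measurable_EFinP; case: mF.
- move=> x _; rewrite /= lee_fin [leRHS]ger0_norm ?addr_ge0 //.
  rewrite -(@ler_pXn2r _ 2) ?nnegrE ?normc_ge0 ?addr_ge0 //.
  rewrite normc_sqr sqrrD !real_normK ?num_real // lerD2r lerDl mulrn_wge0 //.
Qed.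

Lemma le_cintegrable F (g : borel X -> R) : cmeasurable F ->
  (forall x, normc (F x) <= g x) -> mu.-integrable setT (EFin \o g) ->
  cintegrable mu F.
Proof.
move=> mF Fg /integrableP[mg ig]; apply/cintegrableP; split=> //.
apply: le_lt_trans ig; apply: ge0_le_integral => //.
- by move=> x _; rewrite lee_fin normc_ge0.
- exact/measurable_EFinP/measurable_normc.
- exact: measurableT_comp.
- by move=> x _; rewrite /= lee_fin; apply: (le_trans (Fg x)); exact: ler_norm.
Qed.

Lemma cintegrableZ (a : R[i]) F : cintegrable mu F ->
  cintegrable mu (fun x => a * F x).
Proof.
move=> /cintegrableP[mF oF]; apply/cintegrableP; split; first exact: cmeasurableZ.
under eq_integral do rewrite normcM EFinM.
rewrite ge0_integralZl_EFin ?normc_ge0 //.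
- by apply: lte_mul_pinfty => //; rewrite lee_fin normc_ge0.
- by move=> x _; rewrite lee_fin normc_ge0.
- exact/measurable_EFinP/measurable_normc.
Qed.

Lemma cintegrableD F G : cintegrable mu F -> cintegrable mu G ->
  cintegrable mu (fun x => F x + G x).
Proof.
move=> [F1 F2] [G1 G2]; split.
- apply: eq_integrable (integrableD _ F1 G1) => // x _.
  by case: (F x) (G x) => ? ? [].
- apply: eq_integrable (integrableD _ F2 G2) => // x _.
  by case: (F x) (G x) => ? ? [].
Qed.

Lemma cintegralD F G : cintegrable mu F -> cintegrable mu G ->
  cintegral mu (fun x => F x + G x) = cintegral mu F + cintegral mu G.
Proof.
move=> [F1 F2] [G1 G2]; rewrite /cintegral; apply/eqP; rewrite eq_complex /=.
apply/andP; split; apply/eqP; rewrite -RintegralD //; apply: eq_Rintegral => x _.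
- by case: (F x) (G x) => ? ? [].
- by case: (F x) (G x) => ? ? [].
Qed.

Lemma cintegralZ (a : R[i]) F : cintegrable mu F ->
  cintegral mu (fun x => a * F x) = a * cintegral mu F.
Proof.
case: a => a b [F1 F2]; rewrite /cintegral; apply/eqP; rewrite eq_complex /=.
have Z (c : R) (f : borel X -> R) : mu.-integrable setT (fun x => (f x)%:E) ->
  mu.-integrable setT (fun x => (c * f x)%:E).
  by move=> /(integrableZl measurableT c); apply: eq_integrable.
apply/andP; split; apply/eqP; rewrite -!RintegralZl //.
- rewrite -RintegralB //; [|exact: Z|exact: Z].
  by apply: eq_Rintegral => x _; case: (F x).
- rewrite -RintegralD //; [|exact: Z|exact: Z].
  by apply: eq_Rintegral => x _; case: (F x).
Qed.

Lemma cintegral_sum (J : Type) (s : seq J) (F : J -> borel X -> R[i]) :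
  (forall i, cintegrable mu (F i)) ->
  cintegrable mu (fun x => \sum_(i <- s) F i x) /\
  cintegral mu (fun x => \sum_(i <- s) F i x) = \sum_(i <- s) cintegral mu (F i).
Proof.
move=> iF; elim: s => [|i s [ih1 ih2]].
  under eq_fun do rewrite big_nil; rewrite big_nil; split.
    by split; apply: integrable0.
  by rewrite /cintegral /= /Rintegral !integral0.
under eq_fun do rewrite big_cons; rewrite big_cons; split.
  exact: cintegrableD.
by rewrite cintegralD // ih2.
Qed.

(** Rotating the value of the integral onto the real axis reduces the triangle
    inequality to the monotonicity of a real integral. *)
Lemma normc_cintegral_le F : cintegrable mu F ->
  ((normc (cintegral mu F))%:E <= \int[mu]_x (normc (F x))%:E)%E.
Proof.
move=> iF; have [u u1 uE] := exists_rotation (cintegral mu F).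
have iuF := cintegrableZ u iF.
have <- : complex.Re (cintegral mu (fun x => u * F x)) = normc (cintegral mu F).
  by rewrite cintegralZ // uE.
have mF := cintegrable_cmeasurable iF.
rewrite /cintegral /= /Rintegral fineK; last first.
  by apply: integrable_fin_num => //; exact: iuF.1.
apply: (le_trans (lee_abs _)); apply: (le_trans (le_abse_integral _ _ _)) => //.
  by have /integrableP[] := iuF.1.
apply: ge0_le_integral => //.
- by apply: measurableT_comp => //; have /integrableP[] := iuF.1.
- exact/measurable_EFinP/measurable_normc.
- move=> x _; rewrite /= lee_fin (le_trans (ler_Re_normc _)) //.
  by rewrite normcM u1 mul1r.
Qed.

End ComplexIntegral.

(** * Measure-theoretic preliminaries *)

Section MeasureLemmas.
Context d {T : measurableType d} {R : realType}.
Variable mu : {measure set T -> \bar R}.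

(** Here sigma-finiteness is a property of a bare measure; inside the proof it
    is packed into a structure so that the product-measure theory applies. *)
Lemma tonelli_of_sigma_finite (sf : sigma_finite setT mu)
    (F : T * T -> \bar R) : measurable_fun setT F -> (forall z, 0 <= F z)%E ->
  [/\ measurable_fun setT (fun x => \int[mu]_y F (x, y))%E,
      measurable_fun setT (fun y => \int[mu]_x F (x, y))%E &
      (\int[mu]_x \int[mu]_y F (x, y) = \int[mu]_y \int[mu]_x F (x, y))%E].
Proof.
move=> mF F0.
pose sfin := isSFinite.Build d T R (Measure.sort mu)
  (sfinite_measure_sigma_finite sf).
pose sigf := isSigmaFinite.Build d T R (Measure.sort mu) sf.
pose m := HB.pack_for (SigmaFiniteMeasure.type T R) (Measure.sort mu) sfin sigf.
have := measurable_fun_fubini_tonelli_F (m2 := m) F mF F0.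
have := measurable_fun_fubini_tonelli_G (m1 := m) F mF F0.
have := fubini_tonelli (m1 := m) (m2 := m) F mF F0.
by split.
Qed.

(** Monotone continuity of the integral in its domain. It cuts tails twice: the
    tail of a voice transform outside a large set, and the tail left over by
    finitely many pieces of a partition. *)
Lemma integral_setC_small (F : T -> \bar R) (A : (set T)^nat) (e : R) :
  measurable_fun setT F -> (forall x, 0 <= F x)%E -> (\int[mu]_x F x < +oo)%E ->
  nondecreasing_seq A -> (forall n, measurable (A n)) ->
  \bigcup_n A n = setT -> 0 < e ->
  exists n, (\int[mu]_(x in ~` A n) F x < e%:E)%E.
Proof.
move=> mF F0 oF ndA mA A1 e0.
have IF : (\int[mu]_x F x)%E \is a fin_num.
  by rewrite ge0_fin_numE // integral_ge0.
have cv := ge0_nondecreasing_set_cvg_integral (mu := mu) ndA mA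
  (fun i => measurable_funS measurableT (@subsetT _ _) mF) (fun _ x _ => F0 x).
rewrite A1 in cv.
have lt : (\int[mu]_x F x - e%:E < \int[mu]_x F x)%E.
  by rewrite lteBlDr // lteDl // lte_fin.
have [n hn] : exists n,
    (\int[mu]_x F x - e%:E < \int[mu]_(x in A n) F x)%E.
  apply: contrapT => H; move: lt; apply/negP; rewrite -leNgt.
  apply: (cvge_to_le cv); apply: nearW => n; rewrite leNgt; apply/negP => h.
  by apply: H; exists n.
exists n; move: hn.
rewrite -[in X in (X - _)%E](setUv (A n)) ge0_integral_setU //=; last 3 first.
- exact: measurableC.
- by rewrite setUv.
- exact/disj_setPCl.
have IA : (\int[mu]_(x in A n) F x)%E \is a fin_num.
  rewrite ge0_fin_numE; last exact: integral_ge0.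
  by apply: le_lt_trans oF; apply: ge0_subset_integral.
by move=> h; rewrite -(lteD2lE _ _ IA) -lteBlDr.
Qed.

End MeasureLemmas.

Lemma countable_enum (T : choiceType) (t0 : T) (D : set T) : countable D ->
  exists e : nat -> T, forall x, D x -> exists n, e n = x.
Proof.
move=> /countable_injP[f f_inj].
(* The default [t0] is taken at the integers that index no element of [D]. *)
exists (fun n => xget t0 [set x | D x /\ f x = n]) => x Dx; exists (f x).
have Px : [set y | D y /\ f y = f x] x by [].
have [Dy fy] := xgetPex t0 (ex_intro _ x Px).
by apply: f_inj => //; rewrite inE.
Qed.

Section BorelSets.
Context {X : ptopologicalType}.

Lemma open_borel (A : set X) : open A -> measurable (A : set (borel X)).
Proof. by move=> oA; exact: sub_sigma_algebra. Qed.

Lemma compact_borel (A : set X) : hausdorff_space X -> compact A ->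
  measurable (A : set (borel X)).
Proof.
move=> hX cA; rewrite -(setCK A); apply: measurableC; apply: open_borel.
by rewrite openC; exact: compact_closed.
Qed.

End BorelSets.

Section Exhaustion.
Context {R : realType} {X : ptopologicalType}.
Variable mu : {measure set (borel X) -> \bar R}.

(** Sets that are small in two respects: their finite measures make Tonelli's
    theorem available, and the bound on the weight lets the Hilbert norm control
    the weighted integrals over them. *)
Record exhaustion (nu : borel X -> R) (K : nat -> set (borel X)) : Prop := {
  exhaustion_measurable : forall n, measurable (K n) ;
  exhaustion_nondecreasing : nondecreasing_seq K ;
  exhaustion_cover : \bigcup_n K n = setT ;
  exhaustion_finite : forall n, (mu (K n) < +oo)%E ;
  exhaustion_bounded : forall n x, K n x -> nu x <= n%:R
}.

Lemma exists_exhaustion (nu : borel X -> R) : hausdorff_space X ->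
  sigma_compact X -> radon mu -> weight nu -> exists K, exhaustion nu K.
Proof.
move=> hX [C [cC C1]] muR [mnu nu1].
have mC n : measurable (C n : set (borel X)) by exact: compact_borel.
pose B n : set (borel X) := \big[setU/set0]_(i < n) C i.
have mB n : measurable (B n) by exact: bigsetU_measurable.
have mN n : measurable [set x | nu x <= n%:R].
  by rewrite -[X in measurable X]setTI; exact: measurable_fun_le.
exists (fun n => B n `&` [set x | nu x <= n%:R]); split.
- by move=> n; exact: measurableI.
- move=> m n mn; apply/subsetPset => x [Bx nux]; split.
    move: Bx; rewrite /B -!bigcup_mkord => -[i /= im Ci].
    by exists i => //=; exact: leq_trans im mn.
  by apply: (le_trans nux); rewrite ler_nat.
- apply/seteqP; split=> // x _.
  have [i _ Cix] : (\bigcup_n C n) x by rewrite C1.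
  pose n := maxn i.+1 (Num.truncn (nu x)).+1.
  exists n => //; split.
    rewrite /B -bigcup_mkord; exists i => //=.
    exact: leq_maxl.
  apply: (@le_trans _ _ (Num.truncn (nu x)).+1%:R).
    by rewrite ltW // truncnS_gt.
  by rewrite ler_nat leq_maxr.
- move=> n; apply: (@le_lt_trans _ _ (mu (B n))).
    by apply: le_measure; rewrite ?inE //; exact: measurableI.
  apply: (le_lt_trans (Boole_inequality mu (fun i _ => mC i))).
  apply: lte_sum_pinfty => i _; exact: (radon_compact_fin muR).
- by move=> n x [].
Qed.

Lemma exhaustion_sigma_finite (nu : borel X -> R) K : exhaustion nu K ->
  sigma_finite setT mu.
Proof.
move=> [mK _ K1 oK _]; exists K; first by rewrite K1.
by move=> i; split.
Qed.

End Exhaustion.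

(** * Step functions with values in the Hilbert space *)

Section StepFunctions.
Context {R : realType} {X : ptopologicalType} {H : completeNormedModType R[i]}.

Definition step (n : nat) (E : nat -> set (borel X)) (h : nat -> H) (y : X) : H :=
  \sum_(k < n) (\1_(E k) y : R)%:C *: h k.

Variables (n : nat) (E : nat -> set (borel X)).
Hypothesis E_disj : trivIset setT E.

Lemma sum_indic_in (a : nat -> R) (y : X) (j : nat) : (j < n)%N -> E j y ->
  \sum_(k < n) (\1_(E k) y : R) * a k = a j.
Proof.
move=> jn Ejy; rewrite (bigD1 (Ordinal jn)) //= indicE mem_set // mul1r.
rewrite big1 ?addr0 // => i ij; rewrite indicE memNset ?mul0r // => Eiy.
move/eqP: ij; apply; apply: val_inj => /=.
by apply: E_disj => //; exists y.
Qed.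

Lemma step_in (h : nat -> H) (y : X) (j : nat) : (j < n)%N -> E j y ->
  step n E h y = h j.
Proof.
move=> jn Ejy; rewrite /step (bigD1 (Ordinal jn)) //= indicE mem_set // scale1r.
rewrite big1 ?addr0 // => i ij; rewrite indicE memNset ?scale0r // => Eiy.
move/eqP: ij; apply; apply: val_inj => /=.
by apply: E_disj => //; exists y.
Qed.

Lemma sum_indic_out (a : nat -> R) (y : X) :
  (forall k, (k < n)%N -> ~ E k y) -> \sum_(k < n) (\1_(E k) y : R) * a k = 0.
Proof.
by move=> nE; rewrite big1 // => i _; rewrite indicE memNset ?mul0r //; exact: nE.
Qed.

Lemma step_out (h : nat -> H) (y : X) :
  (forall k, (k < n)%N -> ~ E k y) -> step n E h y = 0.
Proof.
by move=> nE; rewrite /step big1 // => i _; rewrite indicE memNset ?scale0r //; exact: nE.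
Qed.

End StepFunctions.

(** * The reproducing formula of a Parseval frame *)

Section ReproducingInequality.
Context {R : realType} {X : ptopologicalType}.
Variable mu : {measure set (borel X) -> \bar R}.
Context {H : completeNormedModType R[i]}.
Variable ip : {dot H for Num.conj}.
Hypothesis ip_norm : forall f : H, ip f f = `|f| ^+ 2.
Variable phi : X -> H.
Hypothesis phi_frame : parseval_frame mu ip phi.
Implicit Types (g h : H) (A : set (borel X)).

Lemma ipC g h : ip g h = (ip h g)^*.
Proof. by rewrite hermC expr0 mul1r. Qed.

Lemma normc_ipC g h : normc (ip g h) = normc (ip h g).
Proof. by rewrite ipC; exact: normc_conj. Qed.

Lemma hnorm_sqrE g : (hnorm g ^+ 2)%:C = ip g g.
Proof.
by rewrite ip_norm rmorphXn /= /hnorm RRe_real // ger0_real.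
Qed.

Lemma cmeasurable_voice g : cmeasurable (fun y : borel X => ip g (phi y)).
Proof. by have [] := phi_frame g. Qed.

Lemma cmeasurable_voiceC h : cmeasurable (fun y : borel X => ip (phi y) h).
Proof.
rewrite (_ : (fun _ => _) = (fun y => (ip h (phi y))^*%C)).
  exact/cmeasurable_conj/cmeasurable_voice.
by apply/funext => y; rewrite ipC.
Qed.

Lemma voice_sqr_integrable g :
  mu.-integrable setT (fun y => (normc (ip g (phi y)) ^+ 2)%:E).
Proof.
have [mg Ig] := phi_frame g; apply/integrableP; split.
  exact/measurable_EFinP/measurable_funX/measurable_normc.
under eq_integral do rewrite /= ger0_norm ?sqr_ge0 //.
by rewrite -Ig ltry.
Qed.

Lemma cintegrable_voiceM g h :
  cintegrable mu (fun y => ip g (phi y) * ip (phi y) h).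
Proof.
pose B (x : borel X) := normc (ip g (phi x)) ^+ 2 + normc (ip h (phi x)) ^+ 2.
apply: (@le_cintegrable _ _ _ _ B).
- by apply: cmeasurableM; [exact: cmeasurable_voice|exact: cmeasurable_voiceC].
- move=> x; rewrite /B normcM (normc_ipC _ h).
  have := sqr_ge0 (normc (ip g (phi x)) - normc (ip h (phi x))).
  have := sqr_ge0 (normc (ip g (phi x)) + normc (ip h (phi x))).
  by nra.
- exact: integrableD (voice_sqr_integrable g) (voice_sqr_integrable h).
Qed.

(** The Parseval identity gives the integral of each square in the polarization
    identity. *)
Lemma Re_reproducing g h :
  \int[mu]_y complex.Re (ip g (phi y) * ip (phi y) h) = complex.Re (ip g h).
Proof.
have sqE u : \int[mu]_y normc (ip u (phi y)) ^+ 2 = complex.Re (ip u u).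
  by rewrite -hnorm_sqrE /= /Rintegral -(phi_frame u).2.
have polar (z w : R[i]) : complex.Re (z * w^*) =
    4^-1 * (normc (z + w) ^+ 2 - normc (z - w) ^+ 2).
  by case: z w => a b [c e]; rewrite !normc_sqr /=; field.
under eq_Rintegral => y _.
  rewrite (ipC (phi y)) polar.
  rewrite -(linearDl ip) -(linearBl ip).
  over.
rewrite RintegralZl //; last first.
  exact: integrableB (voice_sqr_integrable _) (voice_sqr_integrable _).
rewrite RintegralB //; try exact: voice_sqr_integrable.
rewrite !sqE linearDl linearBl !linearBr !linearDr /= (ipC h g).
by case: (ip g g) (ip g h) (ip h h) => a b [c e] [a' b'] /=; field.
Qed.

(** Multiplying [g] by [- 'i] turns imaginary parts into real parts, which the
    previous lemma handles. *)
Lemma reproducing g h :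
  ip g h = cintegral mu (fun y => ip g (phi y) * ip (phi y) h).
Proof.
rewrite /cintegral Re_reproducing.
apply/eqP; rewrite eq_complex /= eqxx /=; apply/eqP.
have := Re_reproducing ((- 'i)%C *: g) h.
rewrite linearZl_LR /= => imE.
transitivity (complex.Re ((- 'i)%C * ip g h)); first by case: (ip g h) => a b /=; ring.
rewrite -imE; apply: eq_Rintegral => y _.
rewrite linearZl_LR /= -mulrA.
by move: (ip g (phi y) * ip (phi y) h) => [a b] /=; ring.
Qed.

(** * The weighted norm of the test space *)

Variable nu : borel X -> R.
Hypothesis nu_weight : weight nu.
Local Notation q := (H1nu_norm mu ip phi nu).
Local Notation H1 := (H1nu mu ip phi nu).

Lemma weight_ge0 x : 0 <= nu x.
Proof. by apply: le_trans (nu_weight.2 x). Qed.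

(** The norm of [H1nu] restricted to a set, so that the norm can be split along
    an exhaustion; it is defined, possibly infinite, on all of [H]. *)
Definition H1nu_norm_on A g : \bar R :=
  (\int[mu]_(x in A) (normc (ip g (phi x)) * nu x)%:E)%E.

Lemma H1nu_normE g : H1nu_norm mu ip phi nu g = H1nu_norm_on setT g.
Proof.
rewrite /H1nu_norm /wLnorm Lnorm1; apply: eq_integral => x _.
by rewrite /= ger0_norm // mulr_ge0 ?normc_ge0 ?weight_ge0.
Qed.

Lemma H1nuE g : H1nu mu ip phi nu g <-> (H1nu_norm mu ip phi nu g < +oo)%E.
Proof.
split=> [[]//|oo]; split=> //; exact: cmeasurable_voice.
Qed.

Lemma measurable_H1nu_integrand A g : measurable A ->
  measurable_fun A (fun x => (normc (ip g (phi x)) * nu x)%:E).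
Proof.
move=> mA; apply: (measurable_funS measurableT) => //.
apply/measurable_EFinP/measurable_funM; last exact: nu_weight.1.
exact/measurable_normc/cmeasurable_voice.
Qed.

Lemma H1nu_norm_on_ge0 A g : (0 <= H1nu_norm_on A g)%E.
Proof.
by apply: integral_ge0 => x _; rewrite lee_fin mulr_ge0 ?normc_ge0 ?weight_ge0.
Qed.

Lemma H1nu_norm_ge0 g : (0 <= H1nu_norm mu ip phi nu g)%E.
Proof. by rewrite H1nu_normE H1nu_norm_on_ge0. Qed.

Lemma H1nu_norm_on_lin_le A (a : R[i]) g h : measurable A ->
  (H1nu_norm_on A (a *: g + h)%R <=
     (normc a)%:E * H1nu_norm_on A g + H1nu_norm_on A h)%E.
Proof.
move=> mA; have pos u x : (0 <= (normc (ip u (phi x)) * nu x)%:E)%E.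
  by rewrite lee_fin mulr_ge0 ?normc_ge0 ?weight_ge0.
rewrite /H1nu_norm_on -ge0_integralZl_EFin ?normc_ge0 //; last first.
  exact: measurable_H1nu_integrand.
rewrite -ge0_integralD //; last 3 first.
- by move=> x _; rewrite mule_ge0 // lee_fin normc_ge0.
- by apply: measurable_funeM; exact: measurable_H1nu_integrand.
- exact: measurable_H1nu_integrand.
apply: ge0_le_integral => //.
- exact: measurable_H1nu_integrand.
- apply: emeasurable_funD; last exact: measurable_H1nu_integrand.
  by apply: measurable_funeM; exact: measurable_H1nu_integrand.
- move=> x _; rewrite -EFinM -EFinD lee_fin mulrA -mulrDl.
  apply: ler_wpM2r; first exact: weight_ge0.
  by rewrite linearPl -normcM; exact: le_normcD.
Qed.

Lemma H1nu_norm_onB A g h : measurable A ->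
  (H1nu_norm_on A (g - h)%R <= H1nu_norm_on A g + H1nu_norm_on A h)%E.
Proof.
move=> mA; rewrite addrC -scaleN1r.
apply: (le_trans (H1nu_norm_on_lin_le _ _ _ mA)).
by rewrite normcN normc1 mul1e addeC.
Qed.

Lemma H1nu_linear (a : R[i]) g h : H1nu mu ip phi nu g -> H1nu mu ip phi nu h ->
  H1nu mu ip phi nu (a *: g + h).
Proof.
move=> /H1nuE gH /H1nuE hH; apply/H1nuE; move: gH hH; rewrite !H1nu_normE => gH hH.
apply: (le_lt_trans (H1nu_norm_on_lin_le _ _ _ measurableT)).
by rewrite lte_add_pinfty // lte_mul_pinfty // lee_fin normc_ge0.
Qed.

Lemma H1nu0 : H1nu mu ip phi nu 0.
Proof.
apply/H1nuE; rewrite H1nu_normE /H1nu_norm_on.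
under eq_integral => x _ do rewrite linear0l normc0 mul0r.
by rewrite integral0 ltry.
Qed.

Lemma H1nu_sum (J : Type) (s : seq J) (a : J -> R[i]) (h : J -> H) :
  (forall i, H1nu mu ip phi nu (h i)) ->
  H1nu mu ip phi nu (\sum_(i <- s) a i *: h i).
Proof.
move=> hH; elim: s => [|i s ih]; first by rewrite big_nil; exact: H1nu0.
by rewrite big_cons; exact: H1nu_linear.
Qed.

Lemma H1nuB g h : H1nu mu ip phi nu g -> H1nu mu ip phi nu h ->
  H1nu mu ip phi nu (g - h).
Proof. by move=> gH hH; rewrite addrC -scaleN1r; exact: H1nu_linear. Qed.

(** Pointwise [a * M <= s * a ^+ 2 + s^-1 * M ^+ 2], and the integral of the
    squared voice transform is at most the squared norm of [H]. The parameter
    [s] is free: making it large shrinks the term that does not depend on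
    [g]. *)
Lemma H1nu_norm_on_le_hnorm A (M s : R) g : measurable A -> 0 < s ->
  (forall x, A x -> nu x <= M) ->
  (H1nu_norm_on A g <= (s * hnorm g ^+ 2)%:E + (s^-1 * M ^+ 2)%:E * mu A)%E.
Proof.
move=> mA s0 nuM.
have msq : measurable_fun A (fun x => (s * normc (ip g (phi x)) ^+ 2)%:E).
  apply: (measurable_funS measurableT) => //.
  apply/measurable_EFinP/measurable_funM; first exact: measurable_cst.
  exact/measurable_funX/measurable_normc/cmeasurable_voice.
have quad (p q : R) : 0 <= p ^+ 2 - p * q + q ^+ 2.
  by have := sqr_ge0 (p - q); have := sqr_ge0 p; have := sqr_ge0 q; nra.
have c0 : 0 <= s^-1 * M ^+ 2 by rewrite mulr_ge0 ?sqr_ge0 // invr_ge0 ltW.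
apply: (@le_trans _ _ (\int[mu]_(x in A)
  ((s * normc (ip g (phi x)) ^+ 2)%:E + (s^-1 * M ^+ 2)%:E))%E).
  apply: ge0_le_integral => //.
  - by move=> x _; rewrite lee_fin mulr_ge0 ?normc_ge0 ?weight_ge0.
  - exact: measurable_H1nu_integrand.
  - exact: emeasurable_funD.
  - move=> x Ax; rewrite -EFinD lee_fin; set a := normc _.
    have a0 : 0 <= a := normc_ge0 _.
    have n0 := weight_ge0 x.
    apply: (@le_trans _ _ (a * M)); first by apply: ler_wpM2l => //; exact: nuM.
    have -> : s * a ^+ 2 + s^-1 * M ^+ 2 =
        a * M + s^-1 * ((s * a) ^+ 2 - (s * a) * M + M ^+ 2).
      by field; rewrite gt_eqF.
    rewrite lerDl mulr_ge0 ?invr_ge0 ?(ltW s0) //.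
rewrite ge0_integralD //; last first.
- by move=> x _; rewrite lee_fin mulr_ge0 ?sqr_ge0 // ltW.
rewrite integral_cst // leeD2r //.
under eq_integral do rewrite EFinM.
rewrite ge0_integralZl_EFin ?(ltW s0) //; last 2 first.
- by move=> x _; rewrite lee_fin sqr_ge0.
- apply: (measurable_funS measurableT) => //.
  exact/measurable_EFinP/measurable_funX/measurable_normc/cmeasurable_voice.
rewrite EFinM lee_pmul2l ?lte_fin //= (phi_frame g).2.
apply: ge0_subset_integral => //.
- exact/measurable_EFinP/measurable_funX/measurable_normc/cmeasurable_voice.
- by move=> x _; rewrite lee_fin sqr_ge0.
Qed.

(** * Separability of the test space *)

Variable K : nat -> set (borel X).
Hypothesis Kexh : exhaustion mu nu K.

(** Density in the norm of [H] suffices on a member of the exhaustion, since the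
    local weighted norm is continuous there. *)
Lemma exists_dense_H1nu_norm_on_lt (e : nat -> H) (n : nat) (g : H) (eps : R) :
  dense (range e) -> 0 < eps -> exists l, (H1nu_norm_on (K n) (g - e l)%R < eps%:E)%E.
Proof.
move=> de eps0.
pose M := fine (mu (K n)).
have muM : mu (K n) = M%:E.
  by rewrite /M fineK // ge0_fin_numE // (exhaustion_finite Kexh).
have M0 : 0 <= M by rewrite fine_ge0.
pose c := n%:R ^+ 2 * M.
have c0 : 0 <= c by rewrite mulr_ge0 // sqr_ge0.
(* With this [s] the term independent of the vector stays below [eps / 2]; the
   radius [dl] then makes the other one smaller than [eps / 2]. *)
pose s := 2 * (c + 1) / eps.
have s0 : 0 < s by rewrite divr_gt0 // mulr_gt0 // ltr_wpDl.
pose dl := Num.sqrt (eps / (2 * s)).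
have e2s : 0 < eps / (2 * s) by rewrite divr_gt0 // mulr_gt0.
have dl0 : 0 < dl by rewrite sqrtr_gt0.
have dlC : 0 < dl%:C :> R[i] by rewrite ltcR.
have [y [gy [l _ ly]]] := de (ball g dl%:C) (ex_intro _ g (ballxx g dlC))
  (ball_open g _).
move: gy; rewrite -ly -ball_normE /= => gel; exists l.
apply: (le_lt_trans (H1nu_norm_on_le_hnorm _
  (exhaustion_measurable Kexh n) s0 (exhaustion_bounded Kexh (n := n)))).
rewrite muM -EFinM -EFinD lte_fin -(mulrA s^-1) -/c.
have hE : hnorm (g - e l) ^+ 2 < eps / (2 * s).
  rewrite -[ltRHS]sqr_sqrtr; last exact: ltW.
  have h0 : (hnorm (g - e l))%:C = `|g - e l| by rewrite /hnorm RRe_real // ger0_real.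
  rewrite ltr_pXn2r ?nnegrE ?sqrtr_ge0 //; last by rewrite -ler0c h0 normr_ge0.
  by rewrite -ltcR h0.
rewrite [ltRHS](_ : eps = s * (eps / (2 * s)) + s^-1 * (c + 1)); last first.
  rewrite /s; field.
  by rewrite !gt_eqF //= ltr_wpDl.
apply: ltrD; first by rewrite ltr_pM2l.
by rewrite ltr_pM2l ?invr_gt0 // ltrDl.
Qed.

Lemma H1nu_norm_tail (g : H) (eps : R) : H1nu mu ip phi nu g -> 0 < eps ->
  exists n, (H1nu_norm_on (~` K n) g < eps%:E)%E.
Proof.
move=> /H1nuE; rewrite H1nu_normE => gH eps0.
apply: integral_setC_small => //.
- exact: measurable_H1nu_integrand.
- by move=> x; rewrite lee_fin mulr_ge0 ?normc_ge0 ?weight_ge0.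
- exact: exhaustion_nondecreasing Kexh.
- exact: exhaustion_measurable Kexh.
- exact: exhaustion_cover Kexh.
Qed.

(** The members of a dense sequence of [H] need not lie in [H1nu]. They serve as
    labels: for each index [n] of the exhaustion and each label [l], one vector
    of [H1nu] is chosen that is close to the label on [K n] and small outside
    [K n], if there is one. Two vectors of [H1nu] sharing a pair [(n, l)] are
    close to each other, and each vector of [H1nu] has such a pair. *)
Lemma H1nu_separable (D : set H) (eps : R) : countable D -> dense D -> 0 < eps ->
  exists h : nat -> H, (forall k, H1nu mu ip phi nu (h k)) /\
    forall g, H1nu mu ip phi nu g -> exists k, (q (g - h k)%R < eps%:E)%E.
Proof.
move=> cD dD eps0.
have [e De] := countable_enum 0 cD.
have de : dense (range e).
  move=> O O0 oO; have [x [Ox Dx]] := dD O O0 oO.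
  by exists x; split=> //; have [n <-] := De x Dx; exists n.
have eps4 : 0 < eps / 4 by rewrite divr_gt0.
pose P (nl : nat * nat) := [set u | [/\ H1nu mu ip phi nu u,
  (H1nu_norm_on (~` K nl.1) u < (eps / 4)%:E)%E &
  (H1nu_norm_on (K nl.1) (u - e nl.2)%R < (eps / 4)%:E)%E]].
pose pt nl : H := xget 0 (P nl).
exists (fun k => if unpickle k is Some nl then pt nl else 0); split.
  move=> k; case: unpickle => [nl|]; last exact: H1nu0.
  by rewrite /pt; case: xgetP => [u _ []//|_]; exact: H1nu0.
move=> g gH.
have [n gn] := H1nu_norm_tail gH eps4.
have [l gl] := exists_dense_H1nu_norm_on_lt n g de eps4.
exists (pickle (n, l)); rewrite pickleK.
have [hH hn hl] : P (n, l) (pt (n, l)) by apply: xgetPex; exists g.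
move: (pt (n, l)) hH hn hl => h hH /= hn hl.
have mK := exhaustion_measurable Kexh n.
rewrite H1nu_normE /H1nu_norm_on -(setUv (K n)) ge0_integral_setU //=;
  last 4 first.
- exact: measurableC.
- rewrite setUv; exact: measurable_H1nu_integrand.
- by move=> x _; rewrite lee_fin mulr_ge0 ?normc_ge0 ?weight_ge0.
- exact/disj_setPCl.
have -> : eps%:E = ((eps / 4)%:E + (eps / 4)%:E + ((eps / 4)%:E + (eps / 4)%:E))%E.
  by rewrite -!EFinD; congr EFin; field.
apply: lteD.
- have -> : g - h = (g - e l) - (h - e l) by rewrite opprB addrA subrK.
  apply: (le_lt_trans (H1nu_norm_onB _ _ mK)).
  exact: lteD.
- apply: (le_lt_trans (H1nu_norm_onB _ _ (measurableC mK))).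
  exact: lteD.
Qed.

(** * Step approximation of the frame *)

Hypothesis phi_schur : schur_kernel mu nu (gram_kernel ip phi).

Lemma cmeasurable_kernel_step n (E : nat -> set (borel X)) (h : nat -> H) :
  (forall k, measurable (E k)) ->
  cmeasurable (fun z : borel X * borel X =>
    ip (phi z.2 - step n E h z.2) (phi z.1)).
Proof.
move=> mE; have -> : (fun z : borel X * borel X =>
    ip (phi z.2 - step n E h z.2) (phi z.1)) =
  (fun z => ip (phi z.2) (phi z.1) -
    \sum_(k < n) (\1_(E k) z.2 : R)%:C * ip (h k) (phi z.1)).
  apply/funext => z; rewrite linearBl linear_sumlz.
  by congr (_ - _); apply: eq_bigr => k _; rewrite linearZl_LR.
apply: cmeasurableB; first exact: phi_schur.1.
apply: cmeasurable_sum => k; apply: cmeasurableM.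
- have mI : measurable_fun setT (\1_(E k) : borel X -> R).
    exact: measurable_indic.
  exact: cmeasurable_real (measurableT_comp mI measurable_snd).
- exact: (cmeasurable_comp (cmeasurable_voice (h k)) measurable_fst).
Qed.

(** Both measurability claims and the exchange of the integrals come from the
    joint measurability of the kernel; the weight [c] will be the modulus of a
    voice transform. *)
Lemma H1nu_norm_step_tonelli n (E : nat -> set (borel X)) (h : nat -> H)
    (c : borel X -> R) : (forall k, measurable (E k)) ->
  measurable_fun setT c -> (forall y, 0 <= c y) ->
  [/\ measurable_fun setT (fun x : borel X => \int[mu]_y
        (c y * normc (ip (phi y - step n E h y) (phi x)) * nu x)%R%:E)%E,
      measurable_fun setT
        (fun y : borel X => (c y)%:E * q (phi y - step n E h y)%R)%E &
      (\int[mu]_x \int[mu]_y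
          (c y * normc (ip (phi y - step n E h y) (phi x)) * nu x)%R%:E =
       \int[mu]_y ((c y)%:E * q (phi y - step n E h y)%R))%E].
Proof.
move=> mE mc c0.
pose F (z : borel X * borel X) : \bar R :=
  (c z.2 * normc (ip (phi z.2 - step n E h z.2) (phi z.1)) * nu z.1)%:E.
have mF : measurable_fun setT F.
  apply/measurable_EFinP; apply: measurable_funM; last first.
    exact: (measurableT_comp nu_weight.1 measurable_fst).
  apply: measurable_funM; first exact: (measurableT_comp mc measurable_snd).
  exact/measurable_normc/cmeasurable_kernel_step.
have F0 z : (0 <= F z)%E.
  by rewrite lee_fin !mulr_ge0 ?normc_ge0 ?weight_ge0.
have [mG' mG swap] := tonelli_of_sigma_finite (exhaustion_sigma_finite Kexh) mF F0.
have GE : (fun y : borel X => \int[mu]_x F (x, y))%E =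
    (fun y : borel X => (c y)%:E * q (phi y - step n E h y)%R)%E.
  apply/funext => y; rewrite H1nu_normE /H1nu_norm_on.
  rewrite -ge0_integralZl_EFin //.
  - by apply: eq_integral => x _; rewrite /F /= -EFinM mulrA.
  - by move=> x _; rewrite lee_fin mulr_ge0 ?normc_ge0 ?weight_ge0.
  - exact: measurable_H1nu_integrand.
split=> //; first by rewrite -GE.
transitivity (\int[mu]_y \int[mu]_x F (x, y))%E; first exact: swap.
exact: (congr1 (fun G => integral mu setT G) GE).
Qed.

Lemma measurable_H1nu_norm_frame (h : H) :
  measurable_fun setT (fun y : borel X => q (phi y - h)%R).
Proof.
(* A constant vector is a step function with a single piece. *)
have [_ + _] := @H1nu_norm_step_tonelli 1 (fun=> setT) (fun=> h) (cst 1)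
  (fun=> measurableT) (@measurable_cst _ _ _ _ _ _) (fun=> ler01).
congr (measurable_fun _ _); apply/funext => y.
by rewrite mul1e /step big_ord1 indicT scale1r.
Qed.

(** Since [nu x <= nu y * m_weight nu x y], the Schur condition on the Gram
    kernel says that the norms of the frame vectors in [H1nu] grow at most like
    the weight. *)
Lemma ae_H1nu_norm_frame_le : exists M : R, 0 <= M /\
  {ae mu, forall y : borel X, (q (phi y) <= (nu y * M)%:E)%E}.
Proof.
have [_] := phi_schur; rewrite gt_max => /andP[_ oo].
set S := ess_sup _ _ in oo.
have [M [M0 SM]] : exists M : R, 0 <= M /\ (S <= M%:E)%E.
  move: oo; case: S => [r| |] // _; last first.
    by exists 0; rewrite lexx leNye.
  by exists (Num.max r 0); rewrite lee_fin !le_max !lexx orbT.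
exists M; split=> //.
have /ess_supP := SM; apply: filterS => y yM.
rewrite H1nu_normE /H1nu_norm_on.
have nuy : 0 < nu y by apply: lt_le_trans (nu_weight.2 y).
have mm : measurable_fun setT (fun x : borel X =>
    (normc (gram_kernel ip phi x y) * m_weight nu x y)%:E).
  apply/measurable_EFinP; apply: measurable_funM.
    exact/measurable_normc/cmeasurable_voice.
  have mnu := nu_weight.1.
  apply: measurable_maxr; first by apply: measurable_funM => //; exact: measurable_cst.
  apply: measurable_funM; first exact: measurable_cst.
  have minv : measurable_fun setT (fun x => (nu x)^-1).
    rewrite (_ : (fun x => _) = (fun x => powR (nu x) (-1))).
      exact: (measurableT_comp (measurable_powR (-1)) mnu).
    by apply/funext => x; rewrite powR_inv1 // weight_ge0.
  exact: minv.
have m0 x : 0 <= m_weight nu x y.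
  by rewrite le_max mulr_ge0 ?invr_ge0 ?weight_ge0.
apply: (@le_trans _ _ ((nu y)%:E * \int[mu]_x
    (normc (gram_kernel ip phi x y) * m_weight nu x y)%:E)%E); last first.
  by rewrite EFinM lee_pmul2l ?lte_fin.
rewrite -ge0_integralZl_EFin //; last 2 first.
- by move=> x _; rewrite lee_fin mulr_ge0 ?normc_ge0.
- exact: ltW.
apply: ge0_le_integral => //.
- by move=> x _; rewrite lee_fin mulr_ge0 ?normc_ge0 ?weight_ge0.
- exact: measurable_H1nu_integrand.
- exact: measurable_funeM.
- move=> x _; rewrite -EFinM lee_fin /gram_kernel mulrCA.
  apply: ler_wpM2l; first exact: normc_ge0.
  by rewrite -ler_pdivrMl // mulrC le_max lexx.
Qed.

Lemma voice_H1nu_norm_lty g : H1 g ->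
  (\int[mu]_y ((normc (ip g (phi y)))%:E * q (phi y)) < +oo)%E.
Proof.
move=> gH; have [M [M0 qM]] := ae_H1nu_norm_frame_le.
have mq : measurable_fun setT (fun y : borel X => q (phi y)).
  have := measurable_H1nu_norm_frame 0.
  by under eq_fun do rewrite subr0.
have mV := measurable_normc (cmeasurable_voice g).
apply: (@le_lt_trans _ _ (M%:E * q g)%E); last first.
  by rewrite lte_mul_pinfty ?lee_fin //; apply/H1nuE.
rewrite (H1nu_normE g) /H1nu_norm_on.
have mI := measurable_H1nu_integrand g measurableT.
rewrite -ge0_integralZl_EFin //; last first.
  by move=> y _; rewrite lee_fin mulr_ge0 ?normc_ge0 ?weight_ge0.
apply: ae_ge0_le_integral => //.
- by move=> y _; rewrite mule_ge0 ?lee_fin ?normc_ge0 // H1nu_norm_ge0.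
- by apply: emeasurable_funM => //; exact/measurable_EFinP.
- move=> y _; rewrite mule_ge0 ?lee_fin // mulr_ge0 ?normc_ge0 //.
  exact: weight_ge0.
- exact: measurable_funeM.
- apply: filterS qM => y qM _.
  apply: (le_trans (lee_wpmul2l _ qM)); first by rewrite lee_fin normc_ge0.
  by rewrite -!EFinM lee_fin mulrA mulrC.
Qed.

Hypothesis phi_H1 : forall x, H1nu mu ip phi nu (phi x).
Variable D : set H.
Hypothesis D_countable : countable D.
Hypothesis D_dense : dense D.

(** The frame takes its values in the separable space [H1nu], hence is within
    [eps] of a countably valued function. Keeping finitely many of its values
    costs the [c]-weighted norm of the frame on the remaining pieces, which is
    the tail of a convergent integral. *)
Lemma exists_step_approximation (c : borel X -> R) (dl : R) :
  measurable_fun setT c -> (forall y, 0 <= c y) ->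
  (\int[mu]_y (c y)%:E < +oo)%E ->
  (\int[mu]_y ((c y)%:E * q (phi y)) < +oo)%E -> 0 < dl ->
  exists (n : nat) (E : nat -> set (borel X)) (h : nat -> H),
    [/\ forall k, measurable (E k), trivIset setT E, forall k, H1 (h k) &
        (\int[mu]_y ((c y)%:E * q (phi y - step n E h y)%R) <= dl%:E)%E].
Proof.
move=> mc c0 oc ocq dl0.
have Ic0 : (0 <= \int[mu]_y (c y)%:E)%E by apply: integral_ge0 => y _; rewrite lee_fin.
pose I := fine (\int[mu]_y (c y)%:E)%E.
have IE : (\int[mu]_y (c y)%:E = I%:E)%E by rewrite fineK // ge0_fin_numE.
have I0 : 0 <= I by rewrite fine_ge0.
(* The error on the pieces that are kept is at most [eps * I < dl / 2]. *)
pose eps := dl / (2 * (I + 1)).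
have eps0 : 0 < eps by rewrite divr_gt0 // mulr_gt0 // ltr_wpDl.
have [h [hH hd]] := H1nu_separable D_countable D_dense eps0.
pose E0 k : set (borel X) := [set y : borel X | (q (phi y - h k)%R < eps%:E)%E].
have mE0 k : measurable (E0 k).
  rewrite -[X in measurable X]setTI; apply: emeasurable_fun_infty_o => //.
  exact: measurable_H1nu_norm_frame.
pose E := seqDU E0.
have mE k : measurable (E k) by exact: seqDU_measurable.
pose A n : set (borel X) := \bigcup_(k < n) E0 k.
have mA n : measurable (A n) by exact: bigcup_measurable.
have AE n y : A n y -> exists2 j, (j < n)%N & E j y.
  rewrite /A bigcup_mkord bigsetU_seqDU -bigcup_mkord.
  by move=> [j /= jn Ej]; exists j.
have EA n k y : (k < n)%N -> E k y -> A n y.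
  move=> kn Eky; rewrite /A bigcup_mkord bigsetU_seqDU -bigcup_mkord.
  by exists k.
have ndA : nondecreasing_seq A.
  move=> m n mn; apply/subsetPset => y [k /= km Eky].
  by exists k => //=; exact: leq_trans km mn.
have A1 : \bigcup_n A n = setT.
  apply/seteqP; split=> // y _; have [k hk] := hd _ (phi_H1 y).
  by exists k.+1 => //; exists k => /=.
have mcq : measurable_fun setT (fun y : borel X => ((c y)%:E * q (phi y))%E).
  apply: emeasurable_funM; first exact/measurable_EFinP.
  have := measurable_H1nu_norm_frame 0.
  by under eq_fun do rewrite subr0.
have q0 u : (0 <= q u)%E := H1nu_norm_ge0 u.
have cq0 u y : (0 <= (c y)%:E * q u)%E by rewrite mule_ge0 // lee_fin.
have dl2 : 0 < dl / 2 by rewrite divr_gt0.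
have [n hn] := integral_setC_small mcq (fun y => cq0 _ y) ocq ndA mA A1 dl2.
exists n, E, h; split=> //; first exact: trivIset_seqDU.
have [_ mcqs _] := H1nu_norm_step_tonelli n h mE mc c0.
apply: (@le_trans _ _ (\int[mu]_y ((eps * c y)%:E +
    ((fun y : borel X => (c y)%:E * q (phi y)) \_ (~` A n)) y))%E).
  apply: ge0_le_integral => //.
  - apply: emeasurable_funD.
      by apply/measurable_EFinP/measurable_funM.
    by apply/(measurable_restrictT _ (measurableC (mA n)))/(measurable_funS measurableT).
  - move=> y _; rewrite patchE; case: ifPn => [|/negP].
      rewrite inE => nAy; rewrite step_out; last first.
        by move=> k kn Eky; apply: nAy; exact: EA kn Eky.
      by rewrite subr0 leeDr // lee_fin mulr_ge0 // ltW.
    rewrite inE => /contrapT /AE[j jn Ejy].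
    rewrite (step_in (trivIset_seqDU _) _ jn Ejy) adde0 mulrC EFinM.
    apply: lee_wpmul2l; first by rewrite lee_fin.
    by apply: ltW; exact: (subset_seqDU Ejy).
rewrite ge0_integralD //; last 4 first.
- by move=> y _; rewrite lee_fin mulr_ge0 // ltW.
- by apply/measurable_EFinP/measurable_funM.
- by move=> y _; apply: erestrict_ge0 => ? _; exact: cq0.
- by apply/(measurable_restrictT _ (measurableC (mA n)))/(measurable_funS measurableT).
rewrite -integral_mkcond.
have -> : dl%:E = ((dl / 2)%:E + (dl / 2)%:E)%E by rewrite -EFinD; congr EFin; field.
apply: leeD; last exact: ltW.
under eq_integral do rewrite EFinM.
rewrite ge0_integralZl_EFin ?(ltW eps0) //; last 2 first.
- by move=> y _; rewrite lee_fin.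
- exact/measurable_EFinP.
rewrite IE -EFinM lee_fin /eps.
have I1 : 0 < I + 1 by rewrite ltr_wpDl.
rewrite mulrAC ler_pdivrMr ?mulr_gt0 //.
have -> : dl / 2 * (2 * (I + 1)) = dl * (I + 1) by field.
by rewrite ler_pM2l // lerDl.
Qed.

(** * Synthesis from a step function *)

Lemma H1nu_integral_lty g : H1 g ->
  (\int[mu]_y (normc (ip g (phi y)))%:E < +oo)%E.
Proof.
move=> /H1nuE; rewrite H1nu_normE.
apply: le_lt_trans; apply: ge0_le_integral => //.
- by move=> y _; rewrite lee_fin normc_ge0.
- exact/measurable_EFinP/measurable_normc/cmeasurable_voice.
- exact: measurable_H1nu_integrand.
- by move=> y _; rewrite lee_fin ler_peMr ?normc_ge0 // nu_weight.2.
Qed.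

Lemma cintegrable_indic_voice (A : set (borel X)) g : measurable A -> H1 g ->
  cintegrable mu (fun y => (\1_A y : R)%:C * ip g (phi y)).
Proof.
move=> mA gH; apply: (@le_cintegrable _ _ _ _ (fun y => normc (ip g (phi y)))).
- apply: cmeasurableM; last exact: cmeasurable_voice.
  by apply: cmeasurable_real; exact: measurable_indic.
- move=> y; rewrite normcM normc_real ler_piMl ?normc_ge0 //.
  by rewrite indicE; case: (_ \in _); rewrite ?normr1 ?normr0.
- apply/integrableP; split.
    exact/measurable_EFinP/measurable_normc/cmeasurable_voice.
  by under eq_integral do rewrite /= ger0_norm ?normc_ge0 //; exact: H1nu_integral_lty.
Qed.

(** The integral of [ip g (phi y) *: step n E h y] over [y], written out as the
    finite sum that it is, so that no vector-valued integral is needed. *)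
Definition synthesis n (E : nat -> set (borel X)) (h : nat -> H) (g : H) : H :=
  \sum_(k < n) cintegral mu (fun y => (\1_(E k) y : R)%:C * ip g (phi y)) *: h k.

(** The reproducing formula represents [g] itself by the frame; subtracting the
    finite sum leaves the frame minus the step function. *)
Lemma voice_sub_synthesis n (E : nat -> set (borel X)) (h : nat -> H) g x :
  (forall k, measurable (E k)) -> H1 g ->
  cintegrable mu (fun y => ip g (phi y) * ip (phi y - step n E h y) (phi x)) /\
  ip (g - synthesis n E h g) (phi x) =
    cintegral mu (fun y => ip g (phi y) * ip (phi y - step n E h y) (phi x)).
Proof.
move=> mE gH.
pose V y := ip g (phi y).
pose F (k : 'I_n) (y : borel X) : R[i] :=
  - ip (h k) (phi x) * ((\1_(E k) y : R)%:C * V y).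
have split_kernel : (fun y => V y * ip (phi y - step n E h y) (phi x)) =
    (fun y => V y * ip (phi y) (phi x) + \sum_(k < n) F k y).
  apply/funext => y; rewrite linearBl mulrBr; congr (_ + _).
  rewrite linear_sumlz mulr_sumr -sumrN; apply: eq_bigr => k _.
  by rewrite linearZl_LR /F /=; ring.
have iF k : cintegrable mu (F k).
  exact: cintegrableZ (cintegrable_indic_voice (mE k) gH).
have [iS eS] := cintegral_sum (index_enum 'I_n) iF.
have iV := cintegrable_voiceM g (phi x).
rewrite split_kernel; split; first exact: cintegrableD.
rewrite cintegralD // eS linearBl.
congr (_ + _); first exact: reproducing.
rewrite linear_sumlz -sumrN; apply: eq_bigr => k _.
rewrite cintegralZ; last exact: cintegrable_indic_voice.
by rewrite linearZl_LR mulNr /= mulrC.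
Qed.

Lemma H1nu_norm_sub_synthesis_le n (E : nat -> set (borel X)) (h : nat -> H) g :
  (forall k, measurable (E k)) -> H1 g ->
  (q (g - synthesis n E h g)%R <=
    \int[mu]_y ((normc (ip g (phi y)))%:E * q (phi y - step n E h y)%R))%E.
Proof.
move=> mE gH; have mV := measurable_normc (cmeasurable_voice g).
have V0 (y : borel X) : 0 <= normc (ip g (phi y)) by exact: normc_ge0.
have [mG _ <-] := H1nu_norm_step_tonelli n h mE mV V0.
rewrite H1nu_normE.
apply: ge0_le_integral => //.
- by move=> x _; rewrite lee_fin mulr_ge0 ?normc_ge0 ?weight_ge0.
- exact: measurable_H1nu_integrand.
- move=> x _.
  have [iE ->] := voice_sub_synthesis n h x mE gH.
  have mabs : measurable_fun setT (fun y : borel X => (normc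
      (ip g (phi y) * ip (phi y - step n E h y) (phi x)))%:E).
    exact/measurable_EFinP/measurable_normc/(cintegrable_cmeasurable iE).
  rewrite EFinM; apply: (le_trans (lee_wpmul2r _ (normc_cintegral_le iE))).
    by rewrite lee_fin weight_ge0.
  rewrite -ge0_integralZr //; last 2 first.
  + by move=> y _; rewrite lee_fin normc_ge0.
  + by rewrite lee_fin weight_ge0.
  by under eq_integral do rewrite -EFinM normcM.
Qed.

(** * Antidual functionals and the reproducing inequality *)

Variable T : H -> R[i].
Hypothesis T_antidual : antidual mu ip phi nu T.

Lemma antidual0 : T 0 = 0.
Proof.
have H0 := H1nu0.
have := T_antidual.1 1 0 0 H0 H0.
rewrite scaler0 addr0 rmorph1 mul1r => /(congr1 (fun z => z - T 0)).
by rewrite subrr addrK => <-.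
Qed.

Lemma antidualB g h : H1 g -> H1 h -> T (g - h) = T g - T h.
Proof.
move=> gH hH; rewrite addrC -scaleN1r T_antidual.1 //.
by rewrite rmorphN1 mulN1r addrC.
Qed.

Lemma normc_antidual_sum_le n (a : nat -> R[i]) (h : nat -> H) :
  (forall k, H1 (h k)) ->
  normc (T (\sum_(k < n) a k *: h k)) <= \sum_(k < n) normc (a k) * normc (T (h k)).
Proof.
move=> hH; elim: n => [|n ih].
  by rewrite !big_ord0 antidual0 normc0.
rewrite !big_ord_recr /= addrC T_antidual.1 //; last exact: H1nu_sum.
apply: (le_trans (le_normcD _ _)); rewrite addrC; apply: lerD => //.
by rewrite normcM normc_conj.
Qed.

Lemma antidual_bound : exists C : R, 0 <= C /\ forall g, H1 g ->
  ((normc (T g))%:E <= C%:E * q g)%E.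
Proof.
have [C TC] := T_antidual.2; exists (Num.max C 0); split.
  by rewrite le_max lexx orbT.
move=> g gH; apply: (le_trans (TC g gH)).
apply: lee_wpmul2r; first exact: H1nu_norm_ge0.
by rewrite lee_fin le_max lexx.
Qed.

Hypothesis T_measurable : cmeasurable (voice phi T).

(** Term by term, the value at the synthesised vector is at most the integral of
    |<g, phi_y>| |T s_y| for the step function [s]; the pieces being disjoint,
    the sum over the pieces is the modulus at the value of [s]. Continuity of
    [T] then exchanges [s] for the frame. *)
Lemma normc_antidual_synthesis_le (C : R) n (E : nat -> set (borel X))
    (h : nat -> H) g :
  0 <= C -> (forall u, H1 u -> ((normc (T u))%:E <= C%:E * q u)%E) ->
  (forall k, measurable (E k)) -> trivIset setT E -> (forall k, H1 (h k)) ->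
  H1 g ->
  ((normc (T (synthesis n E h g)))%:E <=
    \int[mu]_y (normc (ip g (phi y)) * normc (T (phi y)))%:E +
    C%:E * \int[mu]_y ((normc (ip g (phi y)))%:E * q (phi y - step n E h y)%R))%E.
Proof.
move=> C0 TC mE dE hH gH.
have mV := measurable_normc (cmeasurable_voice g).
have mT := measurable_normc T_measurable.
have V0 (y : borel X) : 0 <= normc (ip g (phi y)) by exact: normc_ge0.
have [_ mq _] := H1nu_norm_step_tonelli n h mE mV V0.
have q0 u : (0 <= q u)%E := H1nu_norm_ge0 u.
have mI k : measurable_fun setT (\1_(E k) : borel X -> R) by exact: measurable_indic.
pose a k := cintegral mu (fun y => (\1_(E k) y : R)%:C * ip g (phi y)).
pose F (k : nat) (y : borel X) : R :=
  normc (ip g (phi y)) * ((\1_(E k) y : R) * normc (T (h k))).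
have F0 k y : 0 <= F k y by rewrite !mulr_ge0 ?normc_ge0 // indicE ler0n.
have mF k : measurable_fun setT (F k).
  by apply: measurable_funM => //; apply: measurable_funM => //; exact: measurable_cst.
have aF k : ((normc (a k) * normc (T (h k)))%:E <= \int[mu]_y (F k y)%:E)%E.
  have iE := cintegrable_indic_voice (mE k) gH.
  rewrite EFinM; apply: (le_trans (lee_wpmul2r _ (normc_cintegral_le iE))).
    by rewrite lee_fin normc_ge0.
  rewrite -ge0_integralZr //; last 3 first.
  - exact/measurable_EFinP/measurable_normc/(cintegrable_cmeasurable iE).
  - by move=> y _; rewrite lee_fin normc_ge0.
  - by rewrite lee_fin normc_ge0.
  apply: ge0_le_integral => //.
  - by move=> y _; rewrite -EFinM lee_fin mulr_ge0 ?normc_ge0.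
  - apply: emeasurable_funM; last exact: measurable_cst.
    exact/measurable_EFinP/measurable_normc/(cintegrable_cmeasurable iE).
  - exact/measurable_EFinP.
  - move=> y _; rewrite -EFinM lee_fin normcM normc_real ger0_norm; last first.
      by rewrite indicE ler0n.
    by rewrite /F mulrCA mulrA.
apply: (@le_trans _ _ (\int[mu]_y (\sum_(k < n) F k y)%:E)%E).
  under eq_integral do rewrite -sumEFin.
  rewrite ge0_integral_sum //; last 2 first.
  - by move=> k; exact/measurable_EFinP.
  - by move=> k y _; rewrite lee_fin.
  apply: (@le_trans _ _ (\sum_(k < n) normc (a k) * normc (T (h k)))%:E).
    rewrite lee_fin.
    exact: normc_antidual_sum_le.
  by rewrite -sumEFin; apply: lee_sum => k _; exact: aF.
rewrite -ge0_integralZl_EFin //; last by move=> y _; rewrite mule_ge0 // lee_fin.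
rewrite -ge0_integralD //; last 4 first.
- by move=> y _; rewrite lee_fin mulr_ge0 ?normc_ge0.
- exact/measurable_EFinP/measurable_funM.
- by move=> y _; rewrite !mule_ge0 // lee_fin.
- exact: measurable_funeM.
apply: ge0_le_integral => //.
- by move=> y _; rewrite lee_fin sumr_ge0.
- apply/measurable_EFinP; apply: measurable_sum => k; exact: mF.
- apply: emeasurable_funD; last exact: measurable_funeM.
  exact/measurable_EFinP/measurable_funM.
move=> y _; rewrite /F -mulr_sumr.
have [[j [jn Ejy]]|nE] := pselect (exists j, (j < n)%N /\ E j y); last first.
  rewrite (sum_indic_out (fun k => normc (T (h k)))); last by move=> k kn Eky; apply: nE; exists k.
  by rewrite mulr0 adde_ge0 ?mule_ge0 ?lee_fin ?mulr_ge0 ?normc_ge0.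
rewrite (sum_indic_in dE (fun k => normc (T (h k))) jn Ejy) (step_in dE _ jn Ejy).
rewrite !EFinM muleCA -ge0_muleDr ?mule_ge0 ?lee_fin ?normc_ge0 //.
apply: lee_wpmul2l; first by rewrite lee_fin.
have := TC _ (H1nuB (phi_H1 y) (hH j)).
move=> /(leeD2l (normc (T (phi y)))%:E); apply: le_trans.
rewrite -EFinD lee_fin antidualB //.
by rewrite -(normcN (_ - _)) opprB; exact: normcB_le.
Qed.

(** What applying [T] under the integral sign of the reproducing formula would
    give. As [T] is continuous only for the norm of [H1nu], [g] is first
    replaced by a synthesised vector close to it in that norm. *)
Lemma reproducing_inequality g : H1 g ->
  ((normc (T g))%:E <=
    \int[mu]_y (normc (ip g (phi y)) * normc (T (phi y)))%:E)%E.
Proof.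
move=> gH; have [C [C0 TC]] := antidual_bound.
apply/lee_addgt0Pr => e e0.
pose dl := e / (2 * (C + 1)).
have C1 : 0 < C + 1 by rewrite ltr_wpDl.
have dl0 : 0 < dl by rewrite divr_gt0 // mulr_gt0.
have [n [E [h [mE dE hH hdl]]]] := exists_step_approximation
  (measurable_normc (cmeasurable_voice g)) (fun _ => normc_ge0 _) (H1nu_integral_lty gH)
  (voice_H1nu_norm_lty gH) dl0.
pose G := synthesis n E h g.
have GH : H1 G by exact: H1nu_sum.
have qG : (q (g - G)%R <= dl%:E)%E.
  apply: le_trans hdl.
  exact: H1nu_norm_sub_synthesis_le.
apply: (@le_trans _ _ ((normc (T G))%:E + (normc (T (g - G)))%:E)%E).
  rewrite -EFinD lee_fin antidualB //.
  exact: normcB_le.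
have le1 : (C%:E * dl%:E <= (e / 2)%:E)%E.
  rewrite -EFinM lee_fin /dl mulrA ler_pdivrMr ?mulr_gt0 //.
  have -> : e / 2 * (2 * (C + 1)) = (C + 1) * e by field.
  by rewrite ler_pM2r // lerDl.
have -> : e%:E = ((e / 2)%:E + (e / 2)%:E)%E by rewrite -EFinD; congr EFin; field.
rewrite addeA; apply: leeD.
  apply: (le_trans (normc_antidual_synthesis_le n C0 TC mE dE hH gH)).
  apply: leeD2l; apply: le_trans le1.
  by apply: lee_wpmul2l; rewrite ?lee_fin.
apply: (le_trans (TC _ (H1nuB gH GH))).
by apply: le_trans le1; apply: lee_wpmul2l; rewrite ?lee_fin.
Qed.

End ReproducingInequality.

(** * Sums over admissible coverings *)

Section Coverings.
Context {R : realType} {X : ptopologicalType} {I : choiceType}.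
Variable U : I -> set X.
Hypothesis U_admissible : admissible_covering (R := R) U.

Lemma covering_meets_compact_finite (C : set X) : compact C ->
  finite_set [set i | U i `&` C !=set0].
Proof.
move=> cC; have [W HW] := choice (cov_locally_finite U_admissible).
have := cC; rewrite compact_cover => /(_ X setT (fun x => (W x)°)).
case=> [x _|x Cx|D _ CD]; first exact: open_interior.
  by exists x => //; have [] := HW x.
have fD : finite_set (\bigcup_(x in [set` D]) [set i | U i `&` W x !=set0]).
  by apply: bigcup_finite => // x _; have [] := HW x.
apply: sub_finite_set fD => i [y [Uiy Cy]].
have [x Dx Wxy] := CD y Cy; exists x => //; exists y; split=> //.
exact: interior_subset.
Qed.

(** Each piece meets some compact set of a countable cover of the space, and each
    compact set meets finitely many pieces. *)
Lemma covering_countable : sigma_compact X -> countable [set: I].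
Proof.
move=> [C [cC C1]].
apply: (@sub_countable _ _ _ (\bigcup_n [set i | U i `&` C n !=set0])).
  apply: subset_card_le => i _; have [y Uiy] := cov_interior U_admissible i.
  have [n _ Cny] : (\bigcup_n C n) y by rewrite C1.
  by exists n => //; exists y; split=> //; exact: interior_subset.
apply: bigcup_countable => [|n _]; first exact: countableP.
exact/finite_set_countable/covering_meets_compact_finite.
Qed.

Lemma cov_sigma_fin_num : cov_sigma (R := R) U \is a fin_num.
Proof.
rewrite ge0_fin_numE; first exact: cov_sigma_fin U_admissible.
have [i _ _] : (\bigcup_i U i) point by rewrite (cov_covers U_admissible).
apply: le_trans (ereal_sup_ubound _); last by exists i.
by rewrite /counting; case: ifPn; rewrite ?lee_fin // lee_pinfty.
Qed.

Lemma cov_sigma_ge0 : 0 <= fine (cov_sigma (R := R) U).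
Proof.
apply: fine_ge0.
have [i _ _] : (\bigcup_i U i) point by rewrite (cov_covers U_admissible).
apply: le_trans (ereal_sup_ubound _); last by exists i.
by rewrite /counting; case: ifPn; rewrite ?lee_fin // lee_pinfty.
Qed.

Lemma cov_sup_ge0 (F : X -> R[i]) i :
  (0 <= ereal_sup [set (normc (F z))%:E | z in U i])%E.
Proof.
have [z /interior_subset Uiz] := cov_interior U_admissible i.
apply: le_trans (ereal_sup_ubound _); last by exists z.
by rewrite lee_fin normc_ge0.
Qed.

Lemma cov_sup_sum_ge0 (F : X -> R[i]) x : (0 <= cov_sup_sum U F x)%E.
Proof.
by apply: esum_ge0 => i _; rewrite mule_ge0 ?cov_sup_ge0 // lee_fin indicE ler0n.
Qed.

(** All the pieces containing [x] meet any one of them, so there are at most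
    [cov_sigma U] of them. *)
Lemma cov_sup_sum_le (F : X -> R[i]) x (b : R) : 0 <= b ->
  (forall i, U i x -> (ereal_sup [set (normc (F z))%:E | z in U i] <= b%:E)%E) ->
  (cov_sup_sum U F x <= (fine (cov_sigma (R := R) U) * b)%:E)%E.
Proof.
move=> b0 Fb.
have [i0 _ Ui0x] : (\bigcup_i U i) x by rewrite (cov_covers U_admissible).
pose J := [set j | U i0 `&` U j !=set0].
have Jsigma : (counting J <= cov_sigma (R := R) U)%E.
  by apply: ereal_sup_ubound; exists i0.
have Jfin : finite_set J.
  have := le_lt_trans Jsigma (cov_sigma_fin U_admissible).
  by rewrite /counting; case: asboolP.
apply: (@le_trans _ _ (\esum_(i in J) b%:E)%E).
  rewrite [leRHS]esum_mkcond; apply: le_esum => i _.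
  have [Uix|nUix] := pselect (U i x).
    rewrite indicE mem_set // mule1 ifT; first exact: Fb.
    by rewrite inE; exists x.
  by rewrite indicE memNset // mule0; case: ifP => _; rewrite lee_fin.
rewrite esum_fset // fsbig_finite //= sumEFin big_const_seq count_predT.
rewrite iter_addr_0 lee_fin -mulr_natl; apply: ler_wpM2r => //.
rewrite -lee_fin fineK ?cov_sigma_fin_num //; apply: le_trans Jsigma.
by rewrite /counting; case: asboolP.
Qed.

(** The index set being countable, the sum over it is a series of measurable
    functions. *)
Lemma measurable_cov_sup_sum (F : X -> R[i]) : sigma_compact X ->
  measurable_fun setT (cov_sup_sum U F : borel X -> \bar R).
Proof.
move=> sX.
have [i0 _ _] : (\bigcup_i U i) point by rewrite (cov_covers U_admissible).
have /countable_injP[r r_inj] := covering_countable sX.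
have [e eK] : exists e : nat -> I, forall i, e (r i) = i.
  exists (fun n => xget i0 [set i | r i = n]) => i.
  have ri : [set j | r j = r i] i by [].
  apply: r_inj; rewrite ?inE //.
  exact: (xgetPex i0 (ex_intro _ i ri)).
have bij : set_bij (range r) setT e.
  split=> [//|m n /[!inE] -[i _ <-] [j _ <-]|i _]; first by rewrite !eK => ->.
  by exists (r i) => //; exists i.
pose a i (x : borel X) : \bar R := (ereal_sup [set (normc (F z))%:E | z in U i] *
  (\1_(U i) x : R)%:E)%E.
have a0 i x : (0 <= a i x)%E.
  by rewrite mule_ge0 ?cov_sup_ge0 // lee_fin indicE ler0n.
have -> : (cov_sup_sum U F : borel X -> \bar R) =
    (fun x => \sum_(n <oo) (if n \in range r then a (e n) x else 0))%E.
  apply/funext => x; rewrite nneseries_esumT; last by move=> n; case: ifP.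
  rewrite -esum_mkcond.
  exact: (@reindex_esum R nat I (range r) setT e (fun i => a i x) bij).
apply: ge0_emeasurable_sum => [n x _ _|n _]; first by case: ifP.
case: (n \in range r); last exact: measurable_cst.
apply: measurable_funeM; apply/measurable_EFinP.
apply: measurable_indic; exact: (cov_measurable U_admissible).
Qed.

End Coverings.

(** * The norm of a bounded kernel operator *)

Section KernelOperators.
Context {R : realType} {X : ptopologicalType}.
Variable mu : {measure set (borel X) -> \bar R}.
Variables (Y : set (borel X -> R[i])) (N : (borel X -> R[i]) -> R).
Hypothesis Y_qbf : QBF_space mu Y N.
Variable K : X -> X -> R[i].
Hypothesis K_bounded : kop_bounded mu Y N K.

Lemma kop_norm_ubound : has_ubound [set N (kop mu K F) | F in [set F | Y F /\ N F <= 1]].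
Proof.
have [mK [C NC]] := K_bounded; exists (Num.max C 0) => _ [F [YF NF1] <-].
apply: (le_trans (NC F YF)).
apply: (@le_trans _ _ (Num.max C 0 * N F)).
  by apply: ler_wpM2r; rewrite ?(qbf_norm_ge0 Y_qbf) // le_max lexx.
by rewrite ler_piMr // le_max lexx orbT.
Qed.

(** The scalar can be pulled out wherever the integral converges, that is almost
    everywhere; elsewhere both integrals are junk values and may not match. *)
Lemma kopZ (a : R[i]) F : Y F ->
  N (kop mu K (fun x => a * F x)) = normc a * N (kop mu K F).
Proof.
move=> YF; have [mK _] := K_bounded; have [iF YKF] := mK F YF.
have [_ YKaF] := mK _ (qbf_scale Y_qbf a YF).
rewrite -(qbf_normZ Y_qbf a YKF).
apply: (qbf_ae Y_qbf (qbf_scale Y_qbf a YKF) (qbf_measurable Y_qbf YKaF) _).2.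
have FF := ae_filter_ringOfSetsType mu.
rewrite /ae_eq; apply: filterS iF => x iFx _; rewrite /kop -cintegralZ //.
by congr cintegral; apply/funext => y; rewrite mulrCA.
Qed.

Lemma kop_norm_le F : Y F -> N (kop mu K F) <= kop_norm mu Y N K * N F.
Proof.
move=> YF; have [_ [C NC]] := K_bounded.
have NF0 := qbf_norm_ge0 Y_qbf YF.
(* A function of quasi-norm zero cannot be normalised, but boundedness with any
   constant already gives quasi-norm zero for its image. *)
have [NF|NF] := eqVneq (N F) 0.
  by have := NC F YF; rewrite NF !mulr0.
have NF_gt0 : 0 < N F by rewrite lt_neqAle eq_sym NF.
pose a : R[i] := ((N F)^-1)%:C.
have na : normc a = (N F)^-1 by rewrite normc_real ger0_norm // invr_ge0.
rewrite -ler_pdivrMr // mulrC -na -kopZ //.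
apply: ub_le_sup; first exact: kop_norm_ubound.
exists (fun x => a * F x) => //; split; first exact: (qbf_scale Y_qbf).
by rewrite (qbf_normZ Y_qbf) // na mulVf.
Qed.

Lemma kop_norm_ge0 : 0 <= kop_norm mu Y N K.
Proof.
have Y0 := qbf_0 Y_qbf; have [mK _] := K_bounded.
have [_ YK0] := mK _ Y0.
apply: le_trans (qbf_norm_ge0 Y_qbf YK0) _.
apply: ub_le_sup; first exact: kop_norm_ubound.
exists (cst 0) => //; split=> //.
by rewrite (_ : N (cst 0) = 0) //; apply/(qbf_norm_eq0 Y_qbf Y0); exact: aeW.
Qed.

End KernelOperators.

(** * Pointwise domination by the kernel, and the estimate *)

Section OscillationKernel.
Context {R : realType} {X : ptopologicalType} {I : choiceType}.
Variable mu : {measure set (borel X) -> \bar R}.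
Context {H : completeNormedModType R[i]}.
Variable ip : {dot H for Num.conj}.
Variables (phi psi : X -> H) (U : I -> set X) (T : H -> R[i]).
Hypothesis phi_frame : parseval_frame mu ip phi.
Hypothesis T_measurable : cmeasurable (voice phi T).

Local Notation Kstar := (cov_kernel_star U ip psi phi).

(** The kernel at [(x, y)] is by definition at least the modulus of
    [ip (psi z) (phi y)] when [z] shares a piece of the covering with [x]. The
    comparison uses its real-valued version, whence the finiteness
    hypothesis. *)
Lemma normc_voice_le_kop (x z : X) : cov_Q U x z ->
  ((normc (T (psi z)))%:E <=
    \int[mu]_y (normc (ip (psi z) (phi y)) * normc (T (phi y)))%:E)%E ->
  {ae mu, forall y : borel X, Kstar x y \is a fin_num} ->
  cintegrable mu (fun y => fine_kernel Kstar x y * (normc (T (phi y)))%:C) ->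
  normc (T (psi z)) <=
    complex.Re (kop mu (fine_kernel Kstar) (fun y => (normc (T (phi y)))%:C) x).
Proof.
move=> Qz rep Kfin [iK _].
pose k (y : borel X) : R := fine (Kstar x y) * normc (T (phi y)).
have kE : (fun y : borel X =>
    complex.Re (fine_kernel Kstar x y * (normc (T (phi y)))%:C)) = k.
  by apply/funext => y; rewrite /fine_kernel -rmorphM.
rewrite /kop /cintegral /= -lee_fin /Rintegral fineK; last first.
  exact: integrable_fin_num.
rewrite (_ : (fun y => _) = (fun y => (k y)%:E)); last first.
  by apply/funext => y; rewrite -kE.
apply: (le_trans rep).
have K0 y : (0 <= Kstar x y)%E.
  apply: le_trans (ereal_sup_ubound _); last by exists z.
  by rewrite lee_fin normc_ge0.
apply: ae_ge0_le_integral => //.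
- by move=> y _; rewrite lee_fin mulr_ge0 ?normc_ge0.
- apply/measurable_EFinP/measurable_funM; last exact: (measurable_normc T_measurable).
  exact/measurable_normc/cmeasurable_voice.
- by move=> y _; rewrite lee_fin mulr_ge0 ?normc_ge0 // fine_ge0.
- by have /integrableP[+ _] := iK; rewrite -kE.
- apply: filterS Kfin => y Kxy _; rewrite lee_fin.
  apply: ler_wpM2r; first exact: normc_ge0.
  rewrite -lee_fin fineK //; apply: ereal_sup_ubound; exists z => //.
  by rewrite normc_ipC.
Qed.

End OscillationKernel.

Theorem lemma2p36 (R : realType) (X : ptopologicalType)
    (X_hausdorff : hausdorff_space X)
    (X_locally_compact : locally_compact [set: X])
    (X_sigma_compact : sigma_compact X)
    (mu : {measure set (borel X) -> \bar R})
    (mu_radon : radon mu)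
    (mu_support : msupport mu = setT)
    (H : completeNormedModType R[i])
    (ip : {dot H for Num.conj})
    (H_hilbert : hilbert_separable ip)
    (phi : X -> H)
    (phi_frame : parseval_frame mu ip phi)
    (nu : X -> R)
    (nu_weight : weight nu)
    (phi_H1 : forall x, H1nu mu ip phi nu (phi x))
    (Y : set (borel X -> R[i])) (N : (borel X -> R[i]) -> R)
    (Y_qbf : QBF_space mu Y N)
    (Y_solid : solid mu Y N)
    (Y_rich : rich Y)
    (phi_F : property_F mu ip phi nu Y N)
    (psi : X -> H)
    (psi_H1 : forall x, H1nu mu ip phi nu (psi x))
    (I : choiceType) (U : I -> set X)
    (U_admissible : admissible_covering (R := R) U)
    (Kstar_bounded : ekop_bounded mu Y N (cov_kernel_star U ip psi phi))
    (f : H -> R[i])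
    (f_Co : coorbit mu ip phi nu Y f) :
  let S := cov_sup_sum U (voice psi f) in
  [/\ {ae mu, forall x : borel X, S x \is a fin_num},
      Y (fun x => (fine (S x))%:C)
    & N (fun x => (fine (S x))%:C)
        <= fine (cov_sigma (R := R) U)
           * kop_norm mu Y N (fine_kernel (cov_kernel_star U ip psi phi))
           * coorbit_norm phi N f].
Proof.
move=> S.
have [ip_norm [D [D_count D_dense]]] := H_hilbert.
have [[_ phi_schur] _ _] := phi_F.
have [K Kexh] := exists_exhaustion X_hausdorff X_sigma_compact mu_radon nu_weight.
have [f_anti Yf] := f_Co.
have mf := qbf_measurable Y_qbf Yf.
have [Kfin Kbnd] := Kstar_bounded.
set Kst := cov_kernel_star U ip psi phi in Kfin Kbnd *.
pose absf : borel X -> R[i] := fun y => (normc (f (phi y)))%:C.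
have [Yabs Nabs] : Y absf /\ N absf <= N (voice phi f).
  apply: Y_solid Yf _; first exact/cmeasurable_real/measurable_normc.
  by apply: aeW => y; rewrite normc_real ger0_norm ?normc_ge0.
have [iabs Ykabs] := Kbnd.1 absf Yabs.
pose b (x : borel X) : R := complex.Re (kop mu (fine_kernel Kst) absf x).
pose sigma := fine (cov_sigma (R := R) U).
have sigma0 : 0 <= sigma := cov_sigma_ge0 U_admissible.
have S0 x : (0 <= S x)%E := cov_sup_sum_ge0 U_admissible (voice psi f) x.
have Sle : {ae mu, forall x : borel X, (S x <= (sigma * b x)%:E)%E}.
  (* Away from the null sets on which the kernel is infinite too often or its
     integral diverges, the domination holds at each point. *)
  apply: filterS2 Kfin iabs => x Kx ix.
  have le_b i z : U i x -> U i z -> normc (f (psi z)) <= b x.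
    move=> Uix Uiz; apply: (normc_voice_le_kop phi_frame mf) => //.
      by exists i.
    exact: (reproducing_inequality ip_norm phi_frame nu_weight Kexh phi_schur
      phi_H1 D_count D_dense f_anti mf (psi_H1 z)).
  apply: (cov_sup_sum_le U_admissible) => [|i Uix].
    (* [b x] dominates the modulus at a point of some piece, hence is nonnegative. *)
    have [i _ Uix] : (\bigcup_i U i) x by rewrite (cov_covers U_admissible).
    exact: le_trans (normc_ge0 _) (le_b i x Uix Uix).
  by apply: ge_ereal_sup => _ [z Uiz <-]; rewrite lee_fin; exact: le_b Uiz.
have Sfin : {ae mu, forall x : borel X, S x \is a fin_num}.
  apply: filterS Sle => x Sx.
  by rewrite ge0_fin_numE //; apply: le_lt_trans Sx _; rewrite ltry.
have [YS NS] : Y (fun x => (fine (S x))%:C) /\ N (fun x => (fine (S x))%:C) <=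
    N (fun x => sigma%:C * kop mu (fine_kernel Kst) absf x).
  apply: Y_solid; last 2 first.
  - exact: qbf_scale Y_qbf _ _ Ykabs.
  - apply: filterS2 Sfin Sle => x Sx Sb.
    rewrite normcM !normc_real (ger0_norm (fine_ge0 (S0 x))) (ger0_norm sigma0).
    rewrite -lee_fin fineK //; apply: (le_trans Sb); rewrite lee_fin.
    by apply: ler_wpM2l => //; apply: le_trans (ler_norm _) (ler_Re_normc _).
  have mS : measurable_fun setT (fun x : borel X => fine (S x)).
    have mfine : measurable_fun setT (@fine R) by exact: fine_measurable.
    apply: (measurableT_comp mfine).
    exact: (measurable_cov_sup_sum U_admissible).
  exact: (cmeasurable_real mS).
split=> //; apply: (le_trans NS).
rewrite (qbf_normZ Y_qbf) // normc_real ger0_norm // -mulrA.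
apply: ler_wpM2l => //; apply: (le_trans (kop_norm_le Y_qbf Kbnd Yabs)).
by apply: ler_wpM2l => //; exact: (kop_norm_ge0 Y_qbf Kbnd).
Qed.
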